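(* Let $d\ge 3$ and let $\mathrm{Pyr}(\beta_{d-1})$ be the pyramid over the $(d-1)$-dimensional cross-polytope $\beta_{d-1}$. Then: (i) $\mathrm{Pyr}(\beta_{d-1})$ has $(d+1)(d-1)!\,2^{d-1}$ flags, partitioned into $d+1$ orbits under its symmetry group. (ii) $\mathrm{Pyr}(\beta_{d-1})$ is $z$-uniform.
   Context: $\mathrm{Pyr}(\beta_{d-1})$ is the $d$-polytope obtained as a pyramid with base $\beta_{d-1}$ (one new vertex, the apex, joined to all vertices of the base); its symmetry group is the automorphism group of its face lattice. For a $d$-polytope $P$, a flag is a maximal chain $F_1\subset F_2\subset\dots\subset F_d$ of proper nonempty faces with $\dim F_i=i-1$. For $1\le i\le d$, $\sigma_i$ is the involution on flags replacing $F_i$ by the unique other face $F_i'\neq F_i$ with $F_{i-1}\subset F_i'\subset F_{i+1}$ (where $F_0=\emptyset$, $F_{d+1}=P$). Put $T=\sigma_d\sigma_{d-1}\cdots\sigma_1$ ($\sigma_1$ applied first). A zigzag is a circuit $Z=(f_1,\dots,f_l)$ of flags (an orbit of $T$, listed cyclically, up to cyclic shift) with $f_{j+1}=T(f_j)$, indices modulo $l$; $l$ is its length. For a flag $f=(F_1,\dots,F_d)$ there is a unique family of faces $(x_{i,j})_{1\le i\le d,1\le j\le d+1-i}$ with $x_{i,1}=F_i$, $\dim x_{i,j}=i-1$, $x_{i,j}\subset x_{i+1,j}$, $x_{i,j}\subset x_{i+1,j-1}$, and $x_{i,j}\ne x_{i,j-1}$ whenever the indices make sense; the reverse of $f$ is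 the flag $f^t=(x_{1,d},x_{2,d-1},\dots,x_{d,1})$. The reverse of $Z=(f_1,\dots,f_l)$ is the zigzag $Z^t=(f_l^t,\dots,f_1^t)$; a zigzag is identified with its reverse. The signature of $Z$ is the pair $(n_I,n_{II})$, where $2n_I$ is the number of $j$ with $\sigma_1(f_j)\in Z$ and $2n_{II}$ is the number of $j$ with $\sigma_1(f_j)\in Z^t$. $P$ is $z$-uniform if all its zigzags have the same length and the same signature. *)

(* Defs.v *)
From HB Require Import structures.
From mathcomp Require Import all_boot all_order all_algebra all_fingroup.
From mathcomp Require Import primitive_action boolp.

Set Implicit Arguments.
Unset Strict Implicit.
Unset Printing Implicit Defensive.

Import Order.TTheory GRing.Theory Num.Theory.
Local Open Scope ring_scope.

Section Polytope.

(* The polytope is the convex hull of the points [P t]; a face of it is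
   represented by the set of indices of the points lying on it. *)
Variables (R : realFieldType) (T : finType) (n : nat) (P : T -> 'rV[R]_n).

(* [S] is cut out by a valid inequality [x *m c <= b].  With [c = 0] this
   yields the two improper faces: [set0] for [b = 1], the whole polytope
   [setT] for [b = 0]. *)
Definition is_face (S : {set T}) : Prop :=
  exists (c : 'cV[R]_n) (b : R),
    (forall t, (P t *m c) 0 0 <= b) /\
    (forall t, (t \in S) = ((P t *m c) 0 0 == b)).

Definition face : Type := {S : {set T} | `[< is_face S >]}.
HB.instance Definition _ := SubFinite.on face.

(* 1 + the dimension of the affine hull of the points of [S]: the linear
   dimension of the span of the points lifted to height 1. *)
Definition affine_rank (S : {set T}) : nat :=
  \dim <<[seq row_mx (1 : 'rV[R]_1) (P t) | t in S]>>%VS.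

Definition face_dim_eq (F : face) (k : nat) : bool :=
  affine_rank (val F) == k.+1.

Definition lattice_aut : {set {perm face}} :=
  [set g : {perm face} | [forall F : face, forall G : face,
     (val (g F) \subset val (g G)) == (val F \subset val G)]].

Lemma group_set_lattice_aut : group_set lattice_aut.
Proof.
apply/group_setP; split.
  by rewrite inE; apply/forallP=> F; apply/forallP=> G; rewrite !perm1.
move=> g h; rewrite !inE => /forallP Hg /forallP Hh.
apply/forallP=> F; apply/forallP=> G; rewrite !permM.
by rewrite (eqP (forallP (Hh (g F)) (g G))) (forallP (Hg F) G).
Qed.

Canonical symmetry_group : {group {perm face}} := Group group_set_lattice_aut.

Section Flags.

(* The dimension of the polytope. *)
Variable d : nat.

(* [tnth f k] is F_{k+1}.  A chain with one proper nonempty face in each of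
   the dimensions 0, ..., d-1 is automatically maximal. *)
Definition is_flag (f : d.-tuple face) : bool :=
  sorted (fun F G : face => val F \proper val G) f &&
  [forall k : 'I_d, [&& val (tnth f k) != set0, val (tnth f k) != setT &
                        face_dim_eq (tnth f k) k]].

Definition flags : {set d.-tuple face} := [set f | is_flag f].

(* F_i for 0 <= i <= d+1, where F_0 is empty and F_{d+1} is the polytope. *)
Definition flag_face (f : d.-tuple face) (i : nat) : {set T} :=
  nth setT (set0 :: [seq val F | F <- f]) i.

(* sigma_i, for 1 <= i <= d.  The default value of [odflt] is irrelevant on
   flags, where the other face exists and is unique. *)
Definition sigma (i : nat) (f : d.-tuple face) : d.-tuple face :=
  [tuple if k.+1 == i
         then odflt (tnth f k)
                [pick G : face | [&& G != tnth f k,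
                                     flag_face f i.-1 \proper val G &
                                     val G \proper flag_face f i.+1]]
         else tnth f k | k < d].

(* sigma_d o ... o sigma_1, sigma_1 being applied first. *)
Definition Tstep (f : d.-tuple face) : d.-tuple face :=
  foldl (fun g i => sigma i g) f (iota 1 d).

(* The index set 1 <= i <= d, 1 <= j <= d+1-i of the array x_{i,j}. *)
Definition in_range (i j : nat) : bool :=
  [&& 0 < i, 0 < j & i + j <= d.+1]%N.

Definition reverse_array (f : d.-tuple face) (x : nat -> nat -> face) : Prop :=
  [/\ forall k : 'I_d, x k.+1 1%N = tnth f k,
      forall i j, in_range i j -> face_dim_eq (x i j) i.-1,
      forall i j, in_range i j -> in_range i.+1 j ->
        val (x i j) \subset val (x i.+1 j),
      forall i j, in_range i j -> in_range i.+1 j.-1 ->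
        val (x i j) \subset val (x i.+1 j.-1)
    & forall i j, in_range i j -> in_range i j.-1 -> x i j <> x i j.-1].

(* f^t = (x_{1,d}, x_{2,d-1}, ..., x_{d,1}); the default is irrelevant on
   flags, where the array exists and is unique. *)
Definition flag_reverse (f : d.-tuple face) : d.-tuple face :=
  odflt f [pick g : d.-tuple face |
    `[< exists2 x, reverse_array f x &
          forall k : 'I_d, tnth g k = x k.+1 (d - k)%N >]].

Definition is_zigzag (Z : seq (d.-tuple face)) : Prop :=
  [/\ Z != [::], {subset Z <= flags}, uniq Z & fcycle Tstep Z].

Definition zigzag_reverse (Z : seq (d.-tuple face)) : seq (d.-tuple face) :=
  rev [seq flag_reverse f | f <- Z].

(* [s] is the pair (n_I, n_II). *)
Definition has_signature (Z : seq (d.-tuple face)) (s : nat * nat) : Prop :=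
  (2 * s.1)%N = count (fun f => sigma 1 f \in Z) Z /\
  (2 * s.2)%N = count (fun f => sigma 1 f \in zigzag_reverse Z) Z.

(* A zigzag and its reverse, which the theory identifies, are both quantified
   over here; they have the same length and signature. *)
Definition z_uniform : Prop :=
  exists (l : nat) (s : nat * nat),
    forall Z, is_zigzag Z -> size Z = l /\ has_signature Z s.

Definition flag_orbits : {set {set d.-tuple face}} :=
  [set orbit ('P * d)%act symmetry_group f | f in flags].

End Flags.
End Polytope.

(* Vertices +e_i and -e_i, for i < n. *)
Definition cross_polytope (R : realFieldType) (n : nat) (t : 'I_n * bool) :
    'rV[R]_n :=
  (-1) ^+ t.2 *: delta_mx 0 t.1.

(* The base is placed in the hyperplane where the last coordinate is 0, the
   apex [None] at the last basis vector. *)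
Definition pyramid (R : realFieldType) (T : finType) (n : nat)
    (P : T -> 'rV[R]_n) (t : option T) : 'rV[R]_(n + 1) :=
  if t is Some u then row_mx (P u) 0 else row_mx 0 1.

Arguments flags {R T n} P d.
Arguments flag_orbits {R T n} P d.
Arguments z_uniform {R T n} P d.

(* Main.v *)
Require Import Defs.
From mathcomp Require Import all_boot all_order all_algebra all_fingroup.
From mathcomp Require Import zify lra.
From mathcomp Require Import primitive_action boolp.

(* A face of the pyramid is a set of base vertices without antipodal pair, or
   the whole base, with or without the apex. A flag thus amounts to a signed
   permutation together with the step at which the apex is added. This step is
   the only invariant under symmetries, since a symmetry cannot move the apex:
   the apex spans an edge with every other vertex, while antipodal vertices do
   not span an edge.

   For (ii), follow the zigzag of a flag starting at the apex. Its [j]-th flag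
   consists of the smallest faces containing [w_j, ..., w_{j+i-1}], where the
   word [w] has the apex at every multiple of [n + 2] and otherwise runs
   through [v_0, ..., v_{n-1}, - v_0, ..., - v_{n-1}] cyclically ([n = d - 1]).
   This zigzag meets flags with every position of the apex, so every zigzag is
   its image under a symmetry, and all lengths and signatures agree. The counts
   in the signature are even since they admit fixed-point-free involutions:
   [sigma_1] for [n_I]; for [n_II], the central symmetry when [n] is even, and
   [sigma_1] followed by a reflection exchanging the zigzag with its reverse
   when [n] is odd. *)

Set Implicit Arguments.
Unset Strict Implicit.
Unset Printing Implicit Defensive.

(** * Combinatorial model of the face lattice: vertex sets, rank, diamond property *)

Section PyramidFaces.

Variable n : nat.
Notation T := (option ('I_n * bool)).
Implicit Types (S L U F G H : {set T}) (t : T).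

Definition base : {set T} := [set~ None].

Definition indep S :=
  [forall i, ~~ ((Some (i, true) \in S) && (Some (i, false) \in S))].

(** The candidate vertex sets of faces; [is_faceE] shows that they are exactly the sets cut out by a
    valid inequality. *)
Definition facial S := (base \subset S) || indep S.

(** One more than the dimension. Faces not containing the base are simplices, so vertices are
    counted; the base has [2n] vertices but rank [n.+1]. *)
Definition rk S : nat := if base \subset S then n.+1 + (None \in S) else #|S|.

Lemma indepP S :
  reflect (forall i b, Some (i, b) \in S -> Some (i, ~~ b) \notin S) (indep S).
Proof.
apply: (iffP forallP) => [H i b | H i].
  by move: (H i); case: b => /= /nandP[] /negbTE h1 h2 //; move: h2; rewrite h1.
by apply/nandP; case: (boolP (Some (i, true) \in S)) => [/H|]; [right|left].
Qed.

Lemma indepS S U : S \subset U -> indep U -> indep S.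
Proof.
move=> /subsetP sSU /indepP iU; apply/indepP => i b /sSU /iU.
by apply: contra => /sSU.
Qed.

Lemma mem_base t : (t \in base) = (t != None).
Proof. by rewrite !inE. Qed.

Lemma base_cover S : base \subset S -> None \in S -> S = setT.
Proof.
move=> /subsetP bS NS; apply/setP => t; rewrite inE.
by case: t => [u|]; rewrite ?NS // bS // mem_base.
Qed.

Lemma base_only S : base \subset S -> None \notin S -> S = base.
Proof.
move=> bS NS; apply/eqP; rewrite eqEsubset bS andbT; apply/subsetP => t tS.
by rewrite mem_base; apply: contraNneq NS => <-.
Qed.

(** The axes met by [S]. Staying inside [option] avoids extracting a value; [None] never occurs, the
    apex having been removed. *)
Definition shadow S := [set omap fst t | t in S :\ None].

Lemma shadow_sub S : shadow S \subset [set~ None].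
Proof.
by apply/subsetP => _ /imsetP[[u|] uS ->]; rewrite !inE // in uS *.
Qed.

Lemma card_shadow S : indep S -> #|S| = (None \in S) + #|shadow S|.
Proof.
move=> /indepP iS; rewrite [in LHS](cardsD1 None).
rewrite /shadow card_in_imset // => -[[i b]|] [[j c]|]; rewrite !inE //=.
move=> iSi jSj [eij]; rewrite -eij in jSj *; move: (iS _ _ iSi) jSj.
by case: b c {iSi} => [] [] // /negPf->.
Qed.

Lemma card_optionC1 : #|[set~ None : option 'I_n]| = n.
Proof. by rewrite cardsC1 card_option card_ord. Qed.

Lemma indep_card S : indep S -> #|S| <= n + (None \in S).
Proof.
move/card_shadow->; rewrite addnC leq_add2r -[X in _ <= X]card_optionC1.
exact: subset_leq_card (shadow_sub S).
Qed.

(** With [n] base vertices and no antipodal pair, the shadow has full size, so each of the [n]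
    antipodal pairs is met. *)
Lemma indep_transversal S i :
  indep S -> n + (None \in S) <= #|S| -> exists b, Some (i, b) \in S.
Proof.
move=> iS; rewrite card_shadow // addnC leq_add2l -{1}card_optionC1 => le_n.
have : shadow S = [set~ None] by apply/eqP; rewrite eqEcard shadow_sub.
move/setP/(_ (Some i)); rewrite !inE => /imsetP[[[j b]|]]; rewrite !inE //=.
by move=> jS [->]; exists b.
Qed.

Lemma rk_indep S : indep S -> ~~ (base \subset S) -> rk S = #|S|.
Proof. by rewrite /rk => _ /negPf->. Qed.

Lemma facialN S : facial S -> ~~ (base \subset S) -> indep S.
Proof. by move=> /orP[->|]. Qed.

(** The delicate case is the passage from an independent set to one containing the base: the former
    has at most [n] base vertices, while the base counts for [n.+1]. *)
Lemma rk_ltn S U : facial S -> facial U -> S \proper U -> rk S < rk U.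
Proof.
move=> fS fU SU; have sSU := proper_sub SU; rewrite /rk.
have [bS|bS] := boolP (base \subset S).
  have bU := subset_trans bS sSU; rewrite bU ltn_add2l.
  have NS : None \notin S.
    by apply: contraTN SU => NS; rewrite (base_cover bS NS) properE subsetT andbF.
  rewrite (negPf NS); suff -> : None \in U by [].
  by apply: contraTT SU => NU; rewrite (base_only bS NS) (base_only bU NU) properxx.
have [bU|bU] := boolP (base \subset U); last exact: proper_card.
apply: leq_ltn_trans (indep_card (facialN fS bS)) _.
rewrite addSn ltnS leq_add2l.
by case: (boolP (None \in S)) => // /(subsetP sSU) ->.
Qed.

Lemma rk_leq S U : facial S -> facial U -> S \subset U -> rk S <= rk U.
Proof.
move=> fS fU; rewrite subEproper => /orP[/eqP->//|pSU].
exact/ltnW/rk_ltn.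
Qed.

Lemma rk_inj S U : facial S -> facial U -> S \subset U -> rk U <= rk S -> S = U.
Proof.
move=> fS fU; rewrite subEproper => /orP[/eqP->//|pSU].
by rewrite leqNgt rk_ltn.
Qed.

Lemma facial_apexU S : facial S -> facial (None |: S).
Proof.
move=> /orP[bS|/indepP iS]; apply/orP.
  by left; apply: subset_trans bS (subsetUr _ _).
by right; apply/indepP => i b; rewrite !inE /=; apply: iS.
Qed.

Lemma base_subD S : (base \subset S :\ None) = (base \subset S).
Proof. by rewrite subsetD1 !inE eqxx andbT. Qed.

Lemma base_subU S : (base \subset None |: S) = (base \subset S).
Proof.
rewrite -[LHS]base_subD -[RHS]base_subD; congr (_ \subset _).
suff -> : (None |: S) :\ None = S :\ None by [].
by apply/setP => -[u|]; rewrite !inE.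
Qed.

Lemma facial_apexD S : facial S -> facial (S :\ None).
Proof.
by rewrite /facial base_subD => /orP[->//|/(indepS (subsetDl _ _)) ->]; rewrite orbT.
Qed.

Lemma rk_apexU S : None \notin S -> rk (None |: S) = (rk S).+1.
Proof.
move=> NS; rewrite /rk base_subU cardsU1 NS !inE eqxx (negPf NS) add1n.
by case: ifP => // _; rewrite addn1 addn0.
Qed.

Lemma rk_apexD S : None \in S -> rk S = (rk (S :\ None)).+1.
Proof. by move=> NS; rewrite -rk_apexU ?setD11 // setD1K. Qed.

(** By cardinality, [L] is the intersection and [U] the union of [F] and [G]. *)
Lemma card_middle L U F G :
    L \subset F -> F \subset U -> L \subset G -> G \subset U ->
    #|F| = #|L|.+1 -> #|G| = #|L|.+1 -> #|U| = #|L|.+2 -> G != F ->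
  G = L :|: (U :\: F).
Proof.
move=> LF FU LG GU cF cG cU GF.
have GIF : L = G :&: F.
  apply/eqP; rewrite eqEcard subsetI LG LF /= -ltnS -cG proper_card //.
  rewrite properE subsetIl /= subsetI subxx /=.
  by apply: contra GF => GF; rewrite eqEcard GF cF cG leqnn.
have GUF : U = G :|: F.
  apply/esym/eqP; rewrite eqEcard subUset GU FU /=.
  by rewrite -(leq_add2r #|G :&: F|) cardsUI -GIF cU cF cG; lia.
rewrite GUF {1}GIF; apply/setP => t; rewrite !inE.
by case: (t \in G) (t \in F) => [] [].
Qed.

(** Treats an upper face containing the base. Since [F] meets every antipodal pair, the vertex that
    [G] adds to [L] has its antipode in [F], and not in [L] because [G] is independent; so it is the
    antipode of the vertex that [F] adds. *)
Lemma middle_antipode L F G :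
    L \subset F -> L \subset G -> indep F -> indep G ->
    (None \in F) = (None \in L) -> (None \in G) = (None \in L) ->
    #|F| = n + (None \in L) -> #|F| = #|L|.+1 -> #|G| = #|L|.+1 -> G != F ->
  G = L :|: [set t | if t is Some (i, b) then Some (i, ~~ b) \in F :\: L else false].
Proof.
move=> LF LG iF iG NF NG nF cF cG GF.
have GL1 : #|G :\: L| = 1 by rewrite cardsD (setIidPr LG) cG subSn // subnn.
have FL1 : #|F :\: L| = 1 by rewrite cardsD (setIidPr LF) cF subSn // subnn.
have /cards1P[y yG] := introT eqP GL1.
have /cards1P[x xF] := introT eqP FL1.
have GE : G = L :|: [set y].
  by rewrite -yG setUC -(setID G L) setUC (setIidPr LG) setUC setDUl;
     apply/setP => t; rewrite !inE;
       move/subsetP: LG => /(_ t); case: (t \in L) => [->|] //=;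
       rewrite ?orbT ?orbF ?andbT.
have : y \in G :\: L by rewrite yG set11.
rewrite !inE => /andP[yL yGm].
have yF : y \notin F.
  apply: contra GF => yF.
  rewrite eqEcard cF cG leqnn andbT GE subUset LF sub1set //.
rewrite {1}GE; congr (_ :|: _).
case: y => [[i b]|] in yG GE yL yGm yF *; last first.
  by rewrite NG (negPf yL) in yGm.
have [c cF'] : exists c, Some (i, c) \in F.
  by apply: indep_transversal; rewrite // nF NF.
have cE : c = ~~ b.
  by apply: contraNeq yF => /eqP; case: (b) (c) cF' => [] [] // ? [].
have cL : Some (i, c) \notin L.
  apply/negP => /(subsetP LG); rewrite cE => h.
  by move/indepP: iG => /(_ _ _ yGm); rewrite h.
have xE : x = Some (i, c) by apply/esym/set1P; rewrite -xF inE cL.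
apply/setP => -[[j a]|]; rewrite !inE //.
move/setP: xF => /(_ (Some (j, ~~ a))); rewrite !inE => ->.
rewrite xE cE; apply/eqP/eqP => -[-> e]; congr (Some (_, _)); rewrite ?e //.
exact: negb_inj.
Qed.

(** Uniqueness of the second face between [L] and [U]. If the apex enters between them, the only
    middle faces are [None |: L] and [U :\ None]. Otherwise either [U] does not contain the base and
    the interval is Boolean, or it does and the middle faces add antipodal vertices. *)
Lemma diamond L U F G H :
    facial L -> facial U -> facial F -> facial G -> facial H ->
    L \subset F -> F \subset U -> L \subset G -> G \subset U ->
    L \subset H -> H \subset U ->
    rk F = (rk L).+1 -> rk G = (rk L).+1 -> rk H = (rk L).+1 ->
    rk U = (rk L).+2 ->
  G != F -> H != F -> G = H.
Proof.
move=> fL fU fF fG fH LF FU LG GU LH HU rF rG rH rU GF HF.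
have [/andP[NU NL]|] := boolP ((None \in U) && (None \notin L)).
  have mid K : facial K -> L \subset K -> K \subset U -> rk K = (rk L).+1 ->
      K = if None \in K then None |: L else U :\ None.
    move=> fK LK KU rK; case: ifP => NK.
      apply/esym/rk_inj; rewrite ?rk_apexU ?rK // ?facial_apexU //.
      by rewrite subUset sub1set NK LK.
    apply: rk_inj; rewrite ?facial_apexD //.
      by rewrite subsetD1 KU NK.
    by rewrite -ltnS -rk_apexD // rU rK.
  move: (mid F fF LF FU rF) (mid G fG LG GU rG) (mid H fH LH HU rH).
  case: ifP => _ eF; case: ifP => _ eG; case: ifP => _ eH;
    by [rewrite eG eH | rewrite eF eG eqxx in GF | rewrite eF eH eqxx in HF].
rewrite negb_and negbK => NLU.
have Nmid (K : {set T}) : L \subset K -> K \subset U -> (None \in K) = (None \in L).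
  move=> /subsetP LK /subsetP KU; apply/idP/idP; last exact: LK.
  by move=> /KU NU; rewrite NU in NLU.
have LU := subset_trans LF FU; have NmU := Nmid U LU (subxx U).
have NmF := Nmid F LF FU; have NmG := Nmid G LG GU; have NmH := Nmid H LH HU.
(* A middle face containing the base would have the rank of [U], as the two agree on the apex. *)
have lt_b K : facial K -> L \subset K -> K \subset U -> rk K = (rk L).+1 ->
    ~~ (base \subset K).
  move=> fK LK KU rK; apply/negP => bK; move: (subset_trans bK KU) => bU.
  by move: rU; rewrite -rK /rk bK bU NmU (Nmid K LK KU) => /eqP; rewrite eqn_leq ltnn andbF.
have bF := lt_b _ fF LF FU rF; have bG := lt_b _ fG LG GU rG.
have bH := lt_b _ fH LH HU rH.
have bL : ~~ (base \subset L) by apply: contra bF => /subset_trans; apply.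
have cL : rk L = #|L| by rewrite /rk (negPf bL).
rewrite cL {1}/rk (negPf bF) in rF; rewrite cL {1}/rk (negPf bG) in rG.
rewrite cL {1}/rk (negPf bH) in rH.
have [bU|bU] := boolP (base \subset U); last first.
  rewrite cL {1}/rk (negPf bU) in rU.
  by rewrite (card_middle LF FU LG GU) // -(card_middle LF FU LH HU).
have nF : #|F| = n + (None \in L).
  by move: rU; rewrite cL -rF {1}/rk bU NmU => -[].
have iF := facialN fF bF; have iG := facialN fG bG; have iH := facialN fH bH.
rewrite (middle_antipode LF LG iF iG NmF NmG nF rF rG GF).
by rewrite -(middle_antipode LF LH iF iH NmF NmH nF rF rH HF).
Qed.

End PyramidFaces.

(** * A criterion for linear independence *)

Section SpanDimension.

Import GRing.Theory.
Local Open Scope ring_scope.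

Variables (R : fieldType) (I : finType) (p : nat).

(** At coordinate [k t] all vectors but [v t] vanish, so reading a linear relation there kills the
    coefficient of [v t]. *)
Lemma dim_span_coord (v : I -> 'rV[R]_p) (k : I -> 'I_p) (S : {set I}) :
    (forall t, t \in S -> v t 0 (k t) != 0) ->
    (forall t u, t \in S -> u \in S -> u != t -> v u 0 (k t) = 0) ->
  \dim <<[seq v t | t in S]>>%VS = #|S|.
Proof.
move=> vt vut; have sz : size [seq v t | t in S] = #|S| by rewrite size_image.
rewrite -sz; apply/eqP; rewrite -/(free _).
suff: free (in_tuple [seq v t | t in S]) by [].
apply/freeP => c c0 i.
have i_lt : (i < #|S|)%N by rewrite -sz.
(* Only serves as the default value of [nth]. *)
have s0 : I := enum_val (Ordinal i_lt).
have nthE (j : 'I_(size [seq v t | t in S])) :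
    (in_tuple [seq v t | t in S])`_j = v (nth s0 (enum S) j).
  by rewrite /= (nth_map s0) // -cardE -sz.
have inS (j : 'I_(size [seq v t | t in S])) : nth s0 (enum S) j \in S.
  by rewrite -mem_enum mem_nth // -cardE -sz.
move/rowP/(_ (k (nth s0 (enum S) i))): c0; rewrite summxE mxE.
rewrite (bigD1 i) //= big1 ?addr0 => [|j ji].
  by rewrite mxE nthE => /eqP; rewrite mulf_eq0 (negPf (vt _ (inS i))) orbF => /eqP.
rewrite mxE nthE vut ?mulr0 //.
by rewrite nth_uniq ?enum_uniq // -cardE -sz.
Qed.

End SpanDimension.

(** * The faces of the pyramid and their dimensions *)

Section PyramidFaceLattice.

Import Order.TTheory GRing.Theory Num.Theory.

Variables (R : realFieldType) (n : nat).
Notation T := (option ('I_n * bool)).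
Notation Pyr := (pyramid (@cross_polytope R n)).

Local Open Scope ring_scope.

Lemma pyramid_lshift (t : T) (j : 'I_n) :
  Pyr t 0 (lshift 1 j) =
  if t is Some (i, b) then (-1) ^+ b * (j == i)%:R else 0.
Proof. by case: t => [[i b]|]; rewrite ?row_mxEl /= !mxE ?eqxx //= eq_sym. Qed.

Lemma pyramid_rshift (t : T) (j : 'I_1) : Pyr t 0 (rshift n j) = (t == None)%:R.
Proof. by case: t => [[i b]|]; rewrite ?row_mxEr /= !mxE ?ord1 ?eqxx. Qed.

Lemma pyramid_form (t : T) (c : 'cV[R]_(n + 1)) :
  (Pyr t *m c) 0 0 = if t is Some (i, b) then (-1) ^+ b * c (lshift 1 i) 0
                     else c (rshift n 0) 0.
Proof.
rewrite mxE big_split_ord /= big_ord1 pyramid_rshift.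
under eq_bigr => j _ do rewrite pyramid_lshift.
case: t => [[i b]|] /=; last by rewrite mul1r big1 ?add0r // => j _; rewrite mul0r.
rewrite mul0r addr0 (bigD1 i) //= big1 ?addr0 => [|j ji].
  by rewrite eqxx mulr1.
by rewrite (negPf ji) mulr0 mul0r.
Qed.

(** If the inequality is tight at both [+e_i] and [-e_i], the bound is 0; validity at every
    antipodal pair then makes all base coefficients vanish, so the whole base lies on the face. *)
Lemma is_face_facial (S : {set T}) : is_face Pyr S -> facial S.
Proof.
case=> c [b0 [le_b inS]]; rewrite /facial orbC -implyNb; apply/implyP.
move=> /forallPn[i]; rewrite negbK !inS !pyramid_form /= expr0 expr1 mul1r mulN1r.
move=> /andP[/eqP e1 /eqP e2].
have b00 : b0 = 0 by lra.
have c0 j : c (lshift 1 j) 0 = 0.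
  have := le_b (Some (j, false)); have := le_b (Some (j, true)).
  rewrite !pyramid_form /= expr0 expr1 mul1r mulN1r b00 oppr_le0 => h1 h2.
  by apply/eqP; rewrite eq_le h1 h2.
apply/subsetP => -[[j b]|]; rewrite !inE // => _.
by rewrite inS pyramid_form c0 mulr0 b00.
Qed.

Lemma facial_is_face (S : {set T}) : facial S -> is_face Pyr S.
Proof.
move=> /orP[bS|/indepP iS].
  (* A functional vanishing on the base, and equal to 0 or -1 at the apex according to whether the
     apex belongs to [S]. *)
  exists (col_mx 0 (if None \in S then 0 else -1)), 0.
  split=> [|] [[j b]|]; rewrite pyramid_form ?col_mxEu ?col_mxEd ?mxE.
  - by rewrite mulr0.
  - by case: ifP => _; rewrite !mxE //= lerN10.
  - by rewrite mulr0 eqxx (subsetP bS) // !inE.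
  - by case: ifP => _; rewrite !mxE ?eqxx //= oppr_eq0 oner_eq0.
(* This functional takes the value 1 on [S] and 0 or -1 at the other vertices. *)
exists (col_mx (\col_j ((Some (j, false) \in S)%:R - (Some (j, true) \in S)%:R))
               (None \in S)%:R%:M), 1.
have v (i : 'I_n) (b : bool) : (-1) ^+ b * (((Some (i, false) \in S)%:R : R) - (Some (i, true) \in S)%:R)
   = (Some (i, b) \in S)%:R - (Some (i, ~~ b) \in S)%:R.
  by case: b; rewrite /= ?expr1 ?expr0 ?mul1r // mulN1r opprB.
split=> [|] [[j b]|]; rewrite pyramid_form ?col_mxEu ?col_mxEd !mxE ?v ?mulr1n.
- by do 2!case: (_ \in S) => /=; lra.
- by case: (_ \in S) => /=; lra.
- case: (boolP (Some (j, b) \in S)) => [/iS/negPf->|_] /=.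
    by rewrite subr0 eqxx.
  by case: (_ \in S) => /=; apply/esym/eqP; lra.
- by case: (_ \in S) => /=; apply/esym/eqP; lra.
Qed.

Lemma is_faceE (S : {set T}) : `[< is_face Pyr S >] = facial S.
Proof. by apply/asboolP/idP => [/is_face_facial|/facial_is_face]. Qed.

Notation lift1 t := (row_mx (1 : 'rV[R]_1) (Pyr t)).

Lemma lift1_0 (t : T) j : lift1 t 0 (lshift _ j) = 1.
Proof. by rewrite row_mxEl ord1 mxE. Qed.

Lemma lift1_l (t : T) (j : 'I_n) :
  lift1 t 0 (rshift 1 (lshift 1 j)) =
  if t is Some (i, b) then (-1) ^+ b * (j == i)%:R else 0.
Proof. by rewrite row_mxEr pyramid_lshift. Qed.

Lemma lift1_r (t : T) (j : 'I_1) :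
  lift1 t 0 (rshift 1 (rshift n j)) = (t == None)%:R.
Proof. by rewrite row_mxEr pyramid_rshift. Qed.

(** In an independent set no two vertices share an axis, the apex having its own; this axis is the
    isolating coordinate [k]. *)
Lemma affine_rank_indep (S : {set T}) : indep S -> affine_rank Pyr S = #|S|.
Proof.
move=> iS; rewrite /affine_rank.
pose k (t : T) : 'I_(1 + (n + 1)) :=
  if t is Some (i, _) then rshift 1 (lshift 1 i) else rshift 1 (rshift n 0).
apply: (@dim_span_coord _ _ _ (fun t => lift1 t) k) => [[[i b]|] _|[[i b]|] [[j c]|] tS uS ut].
- by rewrite lift1_l eqxx mulr1 signr_eq0.
- by rewrite lift1_r eqxx oner_eq0.
- rewrite lift1_l; case: eqP => [ij|_]; last by rewrite mulr0.
  move/indepP: iS => /(_ _ _ tS); move: ut uS; rewrite ij.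
  by case: (b) (c) => [] []; rewrite ?eqxx // => _ ->.
- by rewrite lift1_l.
- by rewrite lift1_r.
- by rewrite eqxx in ut.
Qed.

Lemma lift_rowP (x y : 'rV[R]_(1 + (n + 1))) :
    x 0 (lshift _ 0) = y 0 (lshift _ 0) ->
    (forall j : 'I_n, x 0 (rshift 1 (lshift 1 j)) = y 0 (rshift 1 (lshift 1 j))) ->
    x 0 (rshift 1 (rshift n 0)) = y 0 (rshift 1 (rshift n 0)) ->
  x = y.
Proof.
move=> e0 e1 e2; apply/rowP => j; case: (split_ordP j) => [j' ->|j' ->].
  by rewrite ord1.
by case: (split_ordP j') => [i ->|i ->] //; rewrite ord1.
Qed.

(** The lifted points span the coordinate subspace on [K]: the height, the [n] base axes, and the
    apex axis when the apex is in [S]. *)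
Lemma affine_rank_base (S : {set T}) :
  (0 < n)%N -> base n \subset S -> affine_rank Pyr S = (n.+1 + (None \in S))%N.
Proof.
move=> n0 bS; rewrite /affine_rank.
pose K : {set 'I_(1 + (n + 1))} := [set j : 'I_(1 + (n + 1)) | (j < n.+1)%N || (None \in S)].
have cK : #|K| = (n.+1 + (None \in S))%N.
  case: (None \in S) @K => /=.
    by rewrite (_ : [set _ | _] = setT) ?cardsT ?card_ord; [lia|apply/setP => j; rewrite !inE orbT].
  rewrite (_ : [set _ | _] = [set~ rshift 1 (rshift n ord0)]).
    by rewrite cardsC1 card_ord; lia.
  by apply/setP => j; rewrite !inE orbF -(inj_eq val_inj) /=; have := ltn_ord j; lia.
rewrite -cK -[in RHS](@dim_span_coord R _ _ (fun j => delta_mx 0 j) id K); first last.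
- by move=> j l _ _ lj; rewrite mxE eq_sym (negPf lj) andbF.
- by move=> j _; rewrite mxE !eqxx oner_eq0.
congr (\dim _); apply/eqP; rewrite eqEsubv; apply/andP; split.
  apply/span_subvP => _ /imageP[t tS ->]; rewrite (row_sum_delta (lift1 t)).
  apply: memv_suml => j _; case: (boolP (j \in K)) => [jK|].
    by apply/memvZ/memv_span/imageP; exists j.
  rewrite inE negb_or -leqNgt => /andP[jn NS].
  have -> : j = rshift 1 (rshift n ord0).
    by apply: val_inj => /=; have := ltn_ord j; lia.
  rewrite lift1_r; case: eqP => [tN|_]; last by rewrite scale0r mem0v.
  by rewrite tN (negPf NS) in tS.
set X := (X in (_ <= X)%VS).
have inX t : t \in S -> lift1 t \in X by move=> tS; apply/memv_span/imageP; exists t.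
have inb (i : 'I_n) b : lift1 (Some (i, b)) \in X.
  by apply/inX/(subsetP bS); rewrite !inE.
have half (x : 'rV[R]_(1 + (n + 1))) : x + x \in X -> x \in X.
  move=> xx; have -> : x = 2^-1 *: (x + x).
    by rewrite -mulr2n -scaler_nat scalerA mulVf ?scale1r // pnatr_eq0.
  exact: memvZ.
have addE (x y : 'rV[R]_(1 + (n + 1))) j : (x + y) 0 j = x 0 j + y 0 j.
  by rewrite mxE.
have oppE (x : 'rV[R]_(1 + (n + 1))) j : (- x) 0 j = - x 0 j by rewrite mxE.
have deltaE (j k : 'I_(1 + (n + 1))) :
    (delta_mx 0 k : 'rV[R]_(1 + (n + 1))) 0 j = (j == k)%:R.
  by rewrite mxE eqxx.
pose entryE := (addE, oppE, deltaE, lift1_0, lift1_l, lift1_r,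
                eq_lshift, eq_rshift, eq_lrshift, eq_rlshift).
have e0 : delta_mx 0 (lshift (n + 1) 0) \in X.
  apply: half; set x := delta_mx _ _.
  (* Two antipodal lifted vertices add up to twice the height vector. *)
  suff <- : lift1 (Some (Ordinal n0, false)) + lift1 (Some (Ordinal n0, true)) = x + x.
    by rewrite rpredD.
  apply: lift_rowP => [|j|]; rewrite !entryE /= ?eqxx ?addr0 //.
  by rewrite expr0 expr1 -mulrDl addrN mul0r.
have ei (i : 'I_n) : delta_mx 0 (rshift 1 (lshift 1 i)) \in X.
  suff <- : lift1 (Some (i, false)) - delta_mx 0 (lshift (n + 1) 0) =
      delta_mx 0 (rshift 1 (lshift 1 i)) by rewrite rpredB.
  by apply: lift_rowP => [|j|]; rewrite !entryE /= ?subr0 ?expr0 ?mul1r ?eqxx ?subrr //.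
apply/span_subvP => _ /imageP[j jK ->].
case: (split_ordP j) => [j' ->|j' ej]; first by rewrite ord1.
case: (split_ordP j') => [i ej'|i ej']; first by rewrite ej ej'.
move: jK; rewrite ej ej' inE /= ord1 => /orP[|NS]; first lia.
suff <- : lift1 None - delta_mx 0 (lshift (n + 1) 0) =
    delta_mx 0 (rshift 1 (rshift n 0)) by rewrite rpredB // inX.
by apply: lift_rowP => [|k|]; rewrite !entryE /= ?subr0 ?eqxx ?subrr //.
Qed.

Lemma affine_rank_facial (S : {set T}) :
  (0 < n)%N -> facial S -> affine_rank Pyr S = rk S.
Proof.
move=> n0 fS; rewrite /rk; case: ifP => bS; first exact: affine_rank_base.
by rewrite affine_rank_indep // facialN // bS.
Qed.

End PyramidFaceLattice.

(** * Extreme ranks, and the existence of a face one rank lower *)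

Section RankExtremes.

Variable n : nat.
Hypothesis n_gt0 : 0 < n.
Notation T := (option ('I_n * bool)).
Implicit Types (S : {set T}).

Lemma indep0 : indep (set0 : {set T}).
Proof. by apply/indepP => i b; rewrite inE. Qed.

Lemma facial0 : facial (set0 : {set T}).
Proof. by rewrite /facial indep0 orbT. Qed.

Lemma facialT : facial ([set: T]).
Proof. by rewrite /facial subsetT. Qed.

Lemma indep_baseN S : indep S -> ~~ (base n \subset S).
Proof.
move=> /indepP iS; apply/negP => /subsetP bS.
have inS b : Some (Ordinal n_gt0, b) \in S by apply: bS; rewrite !inE.
by move: (iS _ _ (inS true)); rewrite inS.
Qed.

Lemma rk_card S : indep S -> rk S = #|S|.
Proof. by move=> iS; rewrite rk_indep // indep_baseN. Qed.

Lemma rk0 : rk (set0 : {set T}) = 0.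
Proof. by rewrite rk_card ?cards0 // indep0. Qed.

Lemma rkT : rk ([set: T]) = n.+2.
Proof. by rewrite /rk subsetT inE addn1. Qed.

Lemma rk_base : rk (base n) = n.+1.
Proof. by rewrite /rk subxx !inE addn0. Qed.

(** Feeds the induction showing that automorphisms preserve rank. One drops the apex if present, any
    vertex of an independent set otherwise; for the base, the simplex of all negative vertices is
    taken. *)
Lemma facial_below S : facial S -> S != set0 ->
  exists S', [/\ facial S', S' \proper S & rk S = (rk S').+1].
Proof.
move=> fS S0; have [NS|NS] := boolP (None \in S).
  exists (S :\ None); split; first exact: facial_apexD.
    by rewrite properD1.
  exact: rk_apexD.
have [bS|bS] := boolP (base n \subset S).
  rewrite (base_only bS NS).
  pose V : {set T} := [set t | if t is Some (_, b) then b else false].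
  have iV : indep V by apply/indepP => i b; rewrite !inE => ->.
  exists V; split; first by rewrite /facial iV orbT.
    rewrite properEneq; apply/andP; split; last first.
      by apply/subsetP => -[[i b]|]; rewrite !inE.
    by apply: contraTneq (indep_baseN iV) => ->; rewrite subxx.
  rewrite rk_base rk_card //; congr _.+1.
  have -> : V = [set Some (i, true) | i : 'I_n].
    apply/setP => -[[i [|]]|]; rewrite !inE; last 2 first.
    - by apply/esym/imsetP => -[].
    - by apply/esym/imsetP => -[].
    by apply/esym/imsetP; exists i.
  by rewrite card_imset ?card_ord // => i j [].
have [t tS] := set0Pn _ S0; have iS := facialN fS bS.
have iSt : indep (S :\ t) by apply: indepS iS; exact: subsetDl.
exists (S :\ t); split; first by rewrite /facial iSt orbT.
  by rewrite properD1.
by rewrite !rk_card // (cardsD1 t) tS.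
Qed.

End RankExtremes.

(** * The hyperoctahedral group acting on the vertices *)

Section SignedPermutations.

Variable n : nat.
Notation T := (option ('I_n * bool)).
Implicit Types (S : {set T}) (s : {perm 'I_n}) (e : 'I_n -> bool).

(** The sign changes on axis [i] when [e i] holds; the apex is fixed. *)
Definition signed_perm s e (t : T) : T :=
  if t is Some (i, b) then Some (s i, b (+) e i) else None.

Definition signed_permV s e := signed_perm s^-1 (fun i => e (s^-1 i)%g).

Lemma signed_permK s e : cancel (signed_perm s e) (signed_permV s e).
Proof. by case=> [[i b]|] //=; rewrite permK addbK. Qed.

Lemma signed_permVK s e : cancel (signed_permV s e) (signed_perm s e).
Proof. by case=> [[i b]|] //=; rewrite permKV addbK. Qed.

Lemma mem_signed_perm s e S t :
  (t \in signed_perm s e @: S) = (signed_permV s e t \in S).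
Proof.
by rewrite -[in LHS](signed_permVK s e t) mem_imset //; apply: can_inj (signed_permK s e).
Qed.

Lemma facial_signed_perm s e S : facial S -> facial (signed_perm s e @: S).
Proof.
move=> /orP[/subsetP bS|/indepP iS]; apply/orP; [left|right].
  by apply/subsetP => -[u|]; rewrite !inE // mem_signed_perm => _; rewrite bS // mem_base; case: u.
apply/indepP => i b; rewrite !mem_signed_perm /= addNb; exact: iS.
Qed.

End SignedPermutations.

(** * Normal form of complete chains of faces *)

Section StandardChains.

Variable n : nat.
Notation T := (option ('I_n * bool)).

(* The number of base vertices in the [r]-th face of a chain that acquires the
   apex at step [a.+1]; the value [n.+1] stands for the whole base. *)
Definition base_rank (a r : nat) : nat := r - (a < r).

(** Axis [i] is used at position [s i], through its vertex of sign [e i]; the apex comes at step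
    [a.+1], and the opposite vertices enter together once the whole base is reached. *)
Definition std_chain (a : nat) (s : {perm 'I_n}) (e : {ffun 'I_n -> bool}) (r : nat) : {set T} :=
  [set t | if t is Some (i, b)
           then (n < base_rank a r) || ((b == e i) && (s i < base_rank a r)) else a < r].

Lemma std_chain_facial a s e r : facial (std_chain a s e r).
Proof.
have [lt_n|le_n] := ltnP n (base_rank a r); apply/orP; [left|right].
  by apply/subsetP => -[[i b]|]; rewrite !inE // lt_n.
apply/indepP => i b; rewrite !inE ltnNge le_n /= => /andP[/eqP-> ->].
by case: (e i).
Qed.

Lemma std_chain0 a s e : std_chain a s e 0 = set0.
Proof. by apply/setP => -[[i b]|]; rewrite !inE // /base_rank ltn0 andbF. Qed.

Lemma std_chainT a s e : a <= n.+1 -> std_chain a s e n.+2 = setT.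
Proof. by move=> a_le; apply/setP => -[[i b]|]; rewrite !inE /base_rank; lia. Qed.

Lemma std_chain_proper a s e r :
  0 < n -> a <= n.+1 -> r <= n.+1 -> std_chain a s e r \proper std_chain a s e r.+1.
Proof.
move=> n0 a_le r_le; rewrite properE; apply/andP; split.
  apply/subsetP => -[[i b]|]; rewrite !inE /base_rank; last lia.
  by case: eqP => _ /=; lia.
apply/subsetPn; case: (eqVneq a r) => [->|ar].
  by exists None; rewrite !inE; lia.
have [lt_n|ge_n] := ltnP (base_rank a r) n.
  exists (Some ((s^-1)%g (Ordinal lt_n), e ((s^-1)%g (Ordinal lt_n))));
    by rewrite !inE eqxx permKV /= ?ltnn; move: lt_n; rewrite /base_rank; lia.
exists (Some (Ordinal n0, ~~ e (Ordinal n0))); rewrite !inE.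
  by move: ge_n; rewrite /base_rank; lia.
by case: (e _); move: ge_n; rewrite /base_rank; lia.
Qed.

(** The permutation [s * s'^-1] sends the axis at a given position of the first chain to the axis at
    that position of the second; the sign function corrects the difference of signs. *)
Lemma std_chain_signed_perm a (s s' : {perm 'I_n}) (e e' : {ffun 'I_n -> bool}) r :
  std_chain a s' e' r =
    signed_perm (s * s'^-1)%g (fun i => e i (+) e' ((s * s'^-1)%g i)) @: std_chain a s e r.
Proof.
apply/setP => t; rewrite mem_signed_perm; case: t => [[i b]|]; rewrite !inE //=.
have -> : ((s * s'^-1)^-1)%g i = (s^-1)%g (s' i).
  by apply: (@perm_inj _ (s * s'^-1)%g); rewrite permKV permM permKV permK.
rewrite permM !permKV permK.
by rewrite addbA (addbC b); case: (e _) (e' _) b => [] [] [].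
Qed.

Lemma std_chain_inj a a' (s s' : {perm 'I_n}) (e e' : {ffun 'I_n -> bool}) :
    a <= n.+1 -> a' <= n.+1 ->
    (forall r, 0 < r <= n.+1 -> std_chain a s e r = std_chain a' s' e' r) ->
  [/\ a = a', s = s' & e = e'].
Proof.
move=> a_le a_le' eq_phi.
have eq_a : a = a'.
  have h r : 0 < r <= n.+1 -> (a < r) = (a' < r).
    by move=> /eq_phi/setP/(_ None); rewrite !inE.
  by have := h a; have := h a'; lia.
subst a'.
have eq_q q i b : 0 < q <= n -> (b == e i) && (s i < q) = (b == e' i) && (s' i < q).
  (* [q + (a <= q)] is a rank at which the chain has exactly [q] base vertices. *)
  move=> q_le; have lvl_q : base_rank a (q + (a <= q)) = q by rewrite /base_rank; lia.
  have r_le : 0 < q + (a <= q) <= n.+1 by lia.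
  move/setP/(_ (Some (i, b))): (eq_phi _ r_le); rewrite !inE lvl_q.
  by have /negPf-> : ~~ (n < q) by lia.
have eq_e i : e i = e' i.
  have n_gt0 : 0 < n <= n by rewrite (leq_ltn_trans _ (ltn_ord i)) /=.
  by apply/eqP; have := eq_q n i (e i) n_gt0; rewrite eqxx !ltn_ord !andbT.
have eq_s i : s i = s' i.
  apply: val_inj => /=; have := ltn_ord (s i); have := ltn_ord (s' i).
  have := eq_q (s i).+1 i (e i); have := eq_q (s' i).+1 i (e i).
  by rewrite eq_e eqxx /=; lia.
by split=> //; [apply/permP|apply/ffunP].
Qed.

Hypothesis n_gt0 : 0 < n.

(** The rank rises strictly from 0 to [n.+2] in [n.+2] steps, hence by one each time. *)
Lemma chain_rank (F : nat -> {set T}) :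
    F 0 = set0 -> F n.+2 = setT -> (forall r, r <= n.+2 -> facial (F r)) ->
    (forall r, r <= n.+1 -> F r \proper F r.+1) ->
  forall r, r <= n.+2 -> rk (F r) = r.
Proof.
move=> F0 FT fF pF r r_le.
have step q : q <= n.+1 -> rk (F q) < rk (F q.+1).
  by move=> q_le; apply: rk_ltn; [exact/fF/leqW|exact/fF|exact/pF].
apply/eqP; rewrite eqn_leq; apply/andP; split.
  have up k : k <= n.+2 -> rk (F (n.+2 - k)) + k <= n.+2.
    elim: k => [_|k IH k_le]; first by rewrite subn0 FT rkT addn0.
    have := step (n.+2 - k.+1); have := IH (ltnW k_le).
    by rewrite (_ : (n.+2 - k.+1).+1 = n.+2 - k); lia.
  by have := up (n.+2 - r); rewrite subKn //; lia.
elim: r r_le => // r IH r_le; apply: leq_ltn_trans (IH _) (step _ _); lia.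
Qed.

(** The data are read off from [lev t], the first step whose face contains [t]. *)
Lemma chain_std (F : nat -> {set T}) :
    F 0 = set0 -> F n.+2 = setT -> (forall r, r <= n.+2 -> facial (F r)) ->
    (forall r, r <= n.+1 -> F r \proper F r.+1) ->
  exists (a : 'I_n.+2) s e, forall r, r <= n.+2 -> F r = std_chain a s e r.
Proof.
move=> F0 FT fF pF; have rkF := chain_rank F0 FT fF pF.
have mono q r : q <= r -> r <= n.+2 -> F q \subset F r.
  elim: r => [|r IH]; first by rewrite leqn0 => /eqP->.
  rewrite leq_eqVlt => /orP[/eqP->//|qr] r_le.
  by apply: subset_trans (IH _ _) (proper_sub (pF _ _)); lia.
have exF t : exists r, t \in F r by exists n.+2; rewrite FT inE.
pose lev t := ex_minn (exF t).
have lev_le t : lev t <= n.+2.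
  by rewrite /lev; case: ex_minnP => r _ /(_ n.+2); rewrite FT inE; apply.
have inF t r : r <= n.+2 -> (t \in F r) = (lev t <= r).
  rewrite /lev; case: ex_minnP => q tq q_min r_le; apply/idP/idP => [/q_min//|q_le].
  exact: subsetP (mono _ _ q_le r_le) _ tq.
have lev_gt0 t : 0 < lev t by have := inF t 0; rewrite F0 inE; lia.
pose a := (lev None).-1.
have a_le : a < n.+2 by have := lev_le None; rewrite /a; have := lev_gt0 None; lia.
have NF r : r <= n.+2 -> (None \in F r) = (a < r).
  by move=> r_le; rewrite inF // /a; have := lev_gt0 None; lia.
have baseF r : r <= n.+2 -> (base n \subset F r) = (n < base_rank a r).
  move=> r_le; have := rkF r r_le; have := fF r r_le; rewrite /rk /facial NF //.
  case: ifP => /= _; first by rewrite /base_rank; lia.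
  by move=> /indep_card; rewrite NF // => + c_eq; rewrite c_eq /base_rank; lia.
have indF r : r <= n.+2 -> base_rank a r <= n -> indep (F r).
  by move=> r_le l_le; apply: facialN; rewrite ?fF // baseF // -leqNgt.
(* The sign of whichever vertex of the antipodal pair enters first. *)
pose e := [ffun i => lev (Some (i, true)) < lev (Some (i, false))].
pose L i := lev (Some (i, e i)).
have inF2 r i b : r <= n.+2 -> base_rank a r <= n ->
    (Some (i, b) \in F r) = (b == e i) && (L i <= r).
  move=> r_le l_le; case: (eqVneq b (e i)) => [->|be] /=; first by rewrite inF.
  apply: contraNF be => ib; move/indepP/(_ _ _ ib): (indF r r_le l_le).
  by move: ib; rewrite !inF // ffunE; case: b => /=; lia.
(* No base vertex enters together with the apex: adding the apex alone already raises the rank by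
   one. *)
have L_a i : L i != a.+1.
  apply/eqP => La.
  have := inF (Some (i, e i)) a; rewrite -/(L i) La ltnn => /(_ ltac:(lia)).
  have /setP : None |: F a = F a.+1.
    apply: rk_inj; rewrite ?facial_apexU ?fF //; try lia.
      by rewrite subUset sub1set NF // ltnSn mono //; lia.
    by rewrite rk_apexU ?NF ?ltnn // ?rkF //; lia.
  by move=> /(_ (Some (i, e i))); rewrite !inE /= => -> ; rewrite inF // -/(L i) La leqnn.
(* The last rank with [n] base vertices. There every antipodal pair is met, which bounds [L]. *)
pose rs := n + (a < n.+1).
have rs_le : rs <= n.+1 by rewrite /rs; lia.
have rs_lvl : base_rank a rs = n by rewrite /rs /base_rank; lia.
have L_rs i : L i <= rs.
  have rs_le2 := leqW rs_le.
  have iF : indep (F rs) by apply: indF; rewrite ?rs_lvl.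
  have cF : n + (None \in F rs) <= #|F rs|.
    by rewrite -(rk_card n_gt0 iF) rkF // NF // /rs; lia.
  have [b] := indep_transversal i iF cF.
  by rewrite inF2 ?rs_lvl // => /andP[].
have lvl_L i : 0 < base_rank a (L i) <= n.
  have := L_rs i; have := L_a i; have := lev_gt0 (Some (i, e i)); rewrite -/(L i).
  by rewrite /base_rank /rs; lia.
have q_lt i : (base_rank a (L i)).-1 < n by have := lvl_L i; lia.
pose q i := Ordinal (q_lt i).
(* Equal positions give equal levels, by [L_a]; two axes entering at the same step would both lie in
   a difference of consecutive faces that is a singleton. *)
have q_inj : injective q.
  move=> i j /(congr1 val) /= eq_q.
  have eqL : L i = L j.
    move: eq_q (lvl_L i) (lvl_L j) (L_a i) (L_a j); rewrite /base_rank; lia.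
  have Li_le : L i <= n.+2 by have := L_rs i; lia.
  have c1 : #|F (L i) :\: F (L i).-1| = 1.
    have l1 : base_rank a (L i) <= n by have := lvl_L i; lia.
    have l2 : base_rank a (L i).-1 <= n by have := lvl_L i; rewrite /base_rank; lia.
    have Li1_le : (L i).-1 <= n.+2 by lia.
    rewrite cardsD (setIidPr (mono _ _ _ _)) ?leq_pred // -!rk_card ?indF // !rkF //.
    by have := lev_gt0 (Some (i, e i)); rewrite -/(L i); lia.
  have inD k : L k = L i -> Some (k, e k) \in F (L i) :\: F (L i).-1.
    move=> eqk; have := lev_gt0 (Some (i, e i)); rewrite -/(L i) => L0.
    by rewrite inE !inF ?eqk -/(L k) ?eqk //; lia.
  move/eqP/cards1P: c1 => [x Dx].
  have := inD i erefl; have := inD j (esym eqL); rewrite Dx !inE.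
  by move=> /eqP <- /eqP [].
exists (Ordinal a_le), (perm q_inj), e => r r_le; apply/setP => -[[i b]|]; last first.
  by rewrite inE NF.
rewrite inE /= permE /=; have [l_gt|l_le] := ltnP n (base_rank a r).
  by move: l_gt; rewrite -baseF // => /subsetP -> //; rewrite mem_base.
rewrite inF2 //=; congr (_ && _).
by have := L_a i; have := lvl_L i; have := L_rs i; rewrite /base_rank; lia.
Qed.

End StandardChains.

(** * Flags of the pyramid, their number and their orbits *)

Section PyramidFlags.

Variables (R : realFieldType) (n : nat).
Hypothesis n_gt1 : 1 < n.
Let n_gt0 : 0 < n := ltnW n_gt1.
Notation T := (option ('I_n * bool)).
Notation Pyr := (pyramid (@cross_polytope R n)).
Notation face := (face Pyr).
Notation d := n.+1.
Notation flag := (d.-tuple face).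
Notation act g f := (('P * d)%act f g).
Implicit Types (F G : face) (f : flag) (S : {set T}) (g : {perm face}).

Lemma face_facial F : facial (val F).
Proof. by rewrite -(is_faceE R) (valP F). Qed.

Lemma is_faceT : `[< is_face Pyr setT >].
Proof. by rewrite is_faceE facialT. Qed.

(** Total, with the whole polytope as value on non-facial sets, so that no proof has to be carried
    along. *)
Definition mkface S : face := insubd (Sub setT is_faceT) S.

Lemma val_mkface S : facial S -> val (mkface S) = S.
Proof. by move=> fS; rewrite val_insubd is_faceE fS. Qed.

Lemma val_faceK F : mkface (val F) = F.
Proof. by apply: val_inj; rewrite val_mkface // face_facial. Qed.

Lemma face_dim_rk F k : face_dim_eq F k = (rk (val F) == k.+1).
Proof. by rewrite /face_dim_eq affine_rank_facial // face_facial. Qed.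

Lemma flag_face0 f : flag_face f 0 = set0.
Proof. by []. Qed.

Lemma flag_faceS f (k : 'I_d) : flag_face f k.+1 = val (tnth f k).
Proof. by rewrite /flag_face /= (nth_map (tnth f k)) ?size_tuple // -tnth_nth. Qed.

Lemma flag_faceT f : flag_face f d.+1 = setT.
Proof. by rewrite /flag_face nth_default //= size_map size_tuple. Qed.

Lemma flag_face_facial f i : i <= d.+1 -> facial (flag_face f i).
Proof.
case: i => [|i] i_le; first by rewrite flag_face0 facial0.
move: i_le; rewrite ltnS leq_eqVlt => /orP[/eqP->|i_lt].
  by rewrite flag_faceT facialT.
by rewrite (flag_faceS f (Ordinal i_lt)) face_facial.
Qed.

(** Once the two improper faces are added, strict inclusions force the dimensions by
    [chain_rank]. *)
Lemma is_flagP f :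
  reflect (forall i, i <= d -> flag_face f i \proper flag_face f i.+1) (is_flag f).
Proof.
apply: (iffP andP) => [[/(sortedP (mkface setT)) sf /forallP ff] i|pf].
  case: i => [|i i_lt].
    by rewrite (flag_faceS f ord0) proper0 => _; case/and3P: (ff ord0).
  rewrite (flag_faceS f (Ordinal i_lt)).
  have [le_d|i_lt'] := leqP d i.+1.
    have -> : i.+2 = d.+1 by lia.
    by rewrite flag_faceT properT; case/and3P: (ff (Ordinal i_lt)).
  rewrite (flag_faceS f (Ordinal i_lt')).
  by rewrite !(tnth_nth (mkface setT)); apply: sf; rewrite size_tuple.
have rkf i : i <= d.+1 -> rk (flag_face f i) = i.
  move=> i_le; apply: (chain_rank n_gt0 (F := flag_face f)) => //.
  - exact: flag_faceT.
  - exact: flag_face_facial.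
split.
  apply/(sortedP (mkface setT)) => i; rewrite size_tuple => i_lt.
  have := pf i.+1 (ltnW i_lt); rewrite (flag_faceS f (Ordinal i_lt)).
  by rewrite (flag_faceS f (Ordinal (ltnW i_lt))) !(tnth_nth (mkface setT)).
apply/forallP => k; rewrite -flag_faceS face_dim_rk -flag_faceS rkf ?eqxx ?andbT ?ltnS ?(ltnW (ltn_ord k)) //.
apply/andP; split.
  rewrite -card_gt0; apply: leq_ltn_trans (leq0n _) (proper_card (pf k _)).
  exact: ltnW.
by rewrite -properT; apply: proper_sub_trans (pf k.+1 _) (subsetT _).
Qed.

Lemma rk_flag f i : f \in flags Pyr d -> i <= d.+1 -> rk (flag_face f i) = i.
Proof.
rewrite inE => /is_flagP pf i_le; apply: (chain_rank n_gt0 (F := flag_face f)) => //.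
- exact: flag_faceT.
- exact: flag_face_facial.
Qed.

Lemma flag_facial_proper f i :
  f \in flags Pyr d -> i <= d -> flag_face f i \proper flag_face f i.+1.
Proof. by rewrite inE => /is_flagP; apply. Qed.

Definition mkflag (x : nat -> {set T}) : flag := [tuple mkface (x k.+1) | k < d].

Lemma flag_face_mkflag x i :
    x 0 = set0 -> x d.+1 = setT -> (forall r, r <= d.+1 -> facial (x r)) ->
  i <= d.+1 -> flag_face (mkflag x) i = x i.
Proof.
move=> x0 xT fx; case: i => [|i]; first by rewrite x0.
rewrite ltnS leq_eqVlt => /orP[/eqP->|i_lt]; first by rewrite xT flag_faceT.
by rewrite (flag_faceS _ (Ordinal i_lt)) tnth_mktuple val_mkface // fx // leqW.
Qed.

Lemma eq_flag f f' :
  (forall i, 0 < i <= d -> flag_face f i = flag_face f' i) -> f = f'.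
Proof.
move=> ff'; apply/eq_from_tnth => k; apply: val_inj.
by rewrite -!flag_faceS ff' //= ltn_ord.
Qed.

Lemma mkflag_flags x :
    x 0 = set0 -> x d.+1 = setT -> (forall r, r <= d.+1 -> facial (x r)) ->
    (forall r, r <= d -> x r \proper x r.+1) ->
  mkflag x \in flags Pyr d.
Proof.
move=> x0 xT fx px; rewrite inE; apply/is_flagP => i i_le.
by rewrite !flag_face_mkflag ?px // ltnW.
Qed.

Section Automorphisms.

Variable g : {perm face}.
Hypothesis g_aut : g \in symmetry_group Pyr.

Lemma aut_subset F G : (val (g F) \subset val (g G)) = (val F \subset val G).
Proof. by move: g_aut; rewrite inE => /forallP/(_ F)/forallP/(_ G)/eqP. Qed.

Lemma aut_proper F G : (val (g F) \proper val (g G)) = (val F \proper val G).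
Proof. by rewrite !properE !aut_subset. Qed.

Lemma aut_face0 : g (mkface set0) = mkface set0.
Proof.
apply: val_inj; apply/eqP; rewrite [X in _ == X]val_mkface ?facial0 //.
have := aut_subset (mkface set0) ((g^-1)%g (mkface set0)).
by rewrite permKV !val_mkface ?facial0 // sub0set subset0.
Qed.

Lemma aut_faceT : g (mkface setT) = mkface setT.
Proof.
apply: val_inj; apply/eqP; rewrite [X in _ == X]val_mkface ?facialT //.
have := aut_subset ((g^-1)%g (mkface setT)) (mkface setT).
by rewrite permKV !val_mkface ?facialT // subsetT subTset.
Qed.

Lemma tnth_act f k : tnth (act g f) k = g (tnth f k).
Proof. by rewrite tnth_map. Qed.

Lemma flag_face_act f i :
  i <= d.+1 -> flag_face (act g f) i = val (g (mkface (flag_face f i))).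
Proof.
case: i => [|i]; first by rewrite !flag_face0 aut_face0 val_mkface ?facial0.
rewrite ltnS leq_eqVlt => /orP[/eqP->|i_lt].
  by rewrite !flag_faceT aut_faceT val_mkface ?facialT.
by rewrite !(flag_faceS _ (Ordinal i_lt)) tnth_act val_faceK.
Qed.

Lemma act_flags f : f \in flags Pyr d -> act g f \in flags Pyr d.
Proof.
move=> ff; rewrite inE; apply/is_flagP => i i_le; rewrite !flag_face_act //; last exact: leqW.
by rewrite aut_proper !val_mkface ?flag_face_facial ?flag_facial_proper // leqW.
Qed.

(** Induction on rank through a face one rank lower, since [g] preserves strict inclusion. Applied
    to the inverse as well, it gives equality. *)
Lemma aut_rk_leq F : rk (val F) <= rk (val (g F)).
Proof.
have [k] := ubnP (rk (val F)); elim: k => // k IH in F *; rewrite ltnS => F_le.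
have [/eqP F0|F0] := boolP (val F == set0); first by rewrite F0 rk0.
have [S [fS SF rF]] := facial_below n_gt0 (face_facial F) F0.
rewrite rF; apply: (@leq_ltn_trans (rk (val (g (mkface S))))).
  rewrite -{1}(val_mkface fS); apply: IH.
  by rewrite val_mkface // -rF.
by apply: rk_ltn; rewrite ?face_facial // aut_proper val_mkface.
Qed.

End Automorphisms.

Lemma aut_rk g F : g \in symmetry_group Pyr -> rk (val (g F)) = rk (val F).
Proof.
move=> g_aut; apply/eqP; rewrite eqn_leq aut_rk_leq // andbT.
by rewrite -{2}(permK g F) aut_rk_leq // groupV.
Qed.

Lemma rk_small S : facial S -> rk S <= n -> indep S.
Proof.
move=> fS; rewrite /rk; case: ifP => bS; first by rewrite addSn ltnNge leq_addr.
by move=> _; apply: facialN; rewrite ?bS.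
Qed.

(* If the apex were moved to a base vertex [u], the edge joining the apex to
   the preimage of [- u] would be mapped to an edge containing [u] and [- u]. *)
Lemma aut_apex g : g \in symmetry_group Pyr -> g (mkface [set None]) = mkface [set None].
Proof.
move=> g_aut; apply: val_inj.
have ind1 (t : T) : indep [set t].
  by apply/indepP => i b; rewrite !inE => /eqP<-; apply/eqP => -[]; case: b.
have fac1 (t : T) : facial [set t] by rewrite /facial ind1 orbT.
have vertex h t : h \in symmetry_group Pyr -> exists u, val (h (mkface [set t])) = [set u].
  move=> h_aut; apply/cards1P; rewrite -rk_card //; last first.
    by apply: rk_small; rewrite ?face_facial // aut_rk // val_mkface // rk_card // cards1.
  by rewrite aut_rk // val_mkface // rk_card // cards1.
have [[[i b]|] gN] := vertex g None g_aut; last by rewrite gN val_mkface.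
have [v gVw] := vertex (g^-1)%g (Some (i, ~~ b)) (groupVr g_aut).
have gw : g (mkface [set v]) = mkface [set Some (i, ~~ b)].
  by rewrite -gVw val_faceK permKV.
have fe : facial (None |: [set v]) by apply: facial_apexU.
have sub_e t : t \in None |: [set v] -> val (g (mkface [set t])) \subset val (g (mkface (None |: [set v]))).
  by move=> te; rewrite aut_subset // !val_mkface // sub1set.
have e1 := sub_e None (setU11 _ _); have e2 := sub_e v (setU1r _ (set11 _)).
rewrite gN sub1set in e1; rewrite gw val_mkface // sub1set in e2.
have : indep (val (g (mkface (None |: [set v])))).
  apply: rk_small; rewrite ?face_facial // aut_rk // val_mkface // rk_card //.
    by rewrite cardsU1 cards1; case: (_ \notin _).
  by apply/indepP => j c; rewrite !inE /= => /eqP ew; move/indepP: (ind1 v) => /(_ j c); rewrite !inE ew; apply.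
by move/indepP/(_ _ _ e1); rewrite e2.
Qed.

Lemma aut_mem_apex g F : g \in symmetry_group Pyr -> (None \in val (g F)) = (None \in val F).
Proof.
move=> g_aut; have fN : facial [set None : T].
  by apply/orP; right; apply/indepP => i b; rewrite !inE.
rewrite -!sub1set -(val_mkface fN) -{1}(aut_apex g_aut); exact: aut_subset.
Qed.

Section FaceMap.

Variables (s : {perm 'I_n}) (e : 'I_n -> bool).

Lemma facial_image F : `[< is_face Pyr (signed_perm s e @: val F) >].
Proof. by rewrite is_faceE facial_signed_perm // face_facial. Qed.

Definition face_map F : face := Sub (signed_perm s e @: val F) (facial_image F).

Lemma face_map_inj : injective face_map.
Proof.
move=> F G eqFG; apply: val_inj.
exact: (imset_inj (can_inj (signed_permK s e)) (congr1 val eqFG)).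
Qed.

Definition signed_aut : {perm face} := perm face_map_inj.

Lemma val_signed_aut F : val (signed_aut F) = signed_perm s e @: val F.
Proof. by rewrite permE SubK. Qed.

Lemma signed_autP : signed_aut \in symmetry_group Pyr.
Proof.
rewrite inE; apply/forallP => F; apply/forallP => G; rewrite !val_signed_aut.
apply/eqP; apply/idP/idP => [/subsetP sFG|]; last exact: imsetS.
apply/subsetP => t /(imset_f (signed_perm s e)) /sFG.
by rewrite mem_imset //; apply: can_inj (signed_permK s e).
Qed.

End FaceMap.

Definition std_flag (a : 'I_n.+2) (s : {perm 'I_n}) (e : {ffun 'I_n -> bool}) : flag :=
  mkflag (std_chain a s e).

Lemma flag_face_std a s e i : i <= d.+1 -> flag_face (std_flag a s e) i = std_chain a s e i.
Proof.
apply: flag_face_mkflag => [||r _]; first exact: std_chain0.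
  by apply: std_chainT; rewrite -ltnS.
exact: std_chain_facial.
Qed.

Lemma std_flag_flags a s e : std_flag a s e \in flags Pyr d.
Proof.
apply: mkflag_flags => [||r r_le|r r_le]; first exact: std_chain0.
- by apply: std_chainT; rewrite -ltnS.
- exact: std_chain_facial.
by apply: std_chain_proper; rewrite // -ltnS.
Qed.

Lemma flags_std f : f \in flags Pyr d -> exists a s e, f = std_flag a s e.
Proof.
move=> ff; have [|||i|a [s [e fE]]] := @chain_std n n_gt0 (flag_face f).
- exact: flag_face0.
- exact: flag_faceT.
- exact: flag_face_facial.
- exact: flag_facial_proper.
exists a, s, e; apply: eq_flag => i /andP[_ i_le].
by rewrite flag_face_std ?fE // leqW.
Qed.

Lemma std_flag_inj a a' s s' e e' :
  std_flag a s e = std_flag a' s' e' -> [/\ a = a', s = s' & e = e'].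
Proof.
move=> eq_f; have a_le (c : 'I_n.+2) : c <= n.+1 by rewrite -ltnS.
have [r /andP[_ /leqW r_le]|/val_inj -> -> ->] :=
  std_chain_inj (a_le a) (a_le a') (s := s) (s' := s') (e := e) (e' := e').
  by rewrite -!flag_face_std // eq_f.
by [].
Qed.

Lemma std_flag_act a (s s' : {perm 'I_n}) (e e' : {ffun 'I_n -> bool}) :
  act (signed_aut (s * s'^-1)%g (fun i => e i (+) e' ((s * s'^-1)%g i)))
      (std_flag a s e) = std_flag a s' e'.
Proof.
apply: eq_flag => i /andP[_ /leqW i_le].
rewrite flag_face_act ?signed_autP // !flag_face_std //.
by rewrite val_signed_aut val_mkface ?std_chain_facial // -std_chain_signed_perm.
Qed.

Lemma std_flag_orbit a s s' e e' :
  std_flag a s' e' \in orbit ('P * d)%act (symmetry_group Pyr) (std_flag a s e).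
Proof. by rewrite -(std_flag_act a s s' e e'); apply/mem_orbit/signed_autP. Qed.

(** Symmetries preserve membership of the apex, and the rank at which the apex appears determines
    [a]. *)
Lemma std_flag_orbit_level a a' s s' e e' :
  std_flag a' s' e' \in orbit ('P * d)%act (symmetry_group Pyr) (std_flag a s e) ->
  a' = a.
Proof.
case/orbitP => g g_aut eq_f.
have h r : r <= d.+1 -> (a' < r) = (a < r).
  move=> r_le.
  have := flag_face_std a' s' e' r_le; rewrite -eq_f flag_face_act // flag_face_std //.
  move/setP/(_ None); rewrite aut_mem_apex // val_mkface ?std_chain_facial //.
  by rewrite !inE.
apply: val_inj => /=; have := h a; have := h a'.
have := ltn_ord a; have := ltn_ord a'; lia.
Qed.

(** The triples [(a, s, e)] parametrize the flags bijectively: [n.+2] apex steps, [n!] orders and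
    [2 ^ n] sign choices. *)
Lemma card_flags : #|flags Pyr d| = ((d + 1) * n`! * 2 ^ n)%N.
Proof.
pose F (p : 'I_n.+2 * {perm 'I_n} * {ffun 'I_n -> bool}) := std_flag p.1.1 p.1.2 p.2.
have -> : flags Pyr d = [set F p | p in setT].
  apply/setP => f; apply/idP/imsetP => [/flags_std[a [s [e ->]]]|[p _ ->]].
    by exists (a, s, e).
  exact: std_flag_flags.
rewrite card_imset => [|[[a s] e] [[a' s'] e'] /std_flag_inj[/= -> -> ->]] //.
rewrite cardsT !card_prod card_ord card_ffun card_bool card_ord addn1.
by rewrite card_Sn.
Qed.

Lemma acts_flags : [acts symmetry_group Pyr, on flags Pyr d | ('P * d)%act].
Proof.
apply/actsP => g g_aut f; apply/idP/idP; last exact: act_flags.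
by move=> /(act_flags (groupVr g_aut)); rewrite actK.
Qed.

Lemma flag_orbits_partition : partition (flag_orbits Pyr d) (flags Pyr d).
Proof. exact/orbit_partition/acts_flags. Qed.

Lemma card_flag_orbits : #|flag_orbits Pyr d| = (d + 1)%N.
Proof.
pose F (a : 'I_n.+2) := orbit ('P * d)%act (symmetry_group Pyr) (std_flag a 1%g [ffun => false]).
have -> : flag_orbits Pyr d = [set F a | a in setT].
  apply/setP => X; apply/imsetP/imsetP => [[f ff ->]|[a _ ->]].
    have [a [s [e ->]]] := flags_std ff; exists a => //.
    by apply/esym/orbit_eqP/std_flag_orbit.
  by exists (std_flag a 1%g [ffun => false]); rewrite // std_flag_flags.
rewrite card_imset ?cardsT ?card_ord ?addn1 // => a a' eqF.
apply: (@std_flag_orbit_level _ _ 1%g 1%g [ffun => false] [ffun => false]).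
by rewrite -/(F a') -eqF; apply: orbit_refl.
Qed.

End PyramidFlags.

(** * Parity of a finite set with a fixed-point-free involution *)

Lemma even_card_involution (I : finType) (A : {set I}) (u : I -> I) :
    (forall x, x \in A -> u x \in A) -> (forall x, x \in A -> u (u x) = x) ->
    (forall x, x \in A -> u x != x) ->
  ~~ odd #|A|.
Proof.
have [k] := ubnP #|A|; elim: k => // k IH in A *; rewrite ltnS => A_le uA uK ux.
have [->|[x xA]] := set_0Vmem A; first by rewrite cards0.
have uxA : u x \in A :\ x by rewrite !inE ux ?uA.
rewrite (cardsD1 x) xA (cardsD1 (u x)) uxA /= negbK; apply: IH.
- by rewrite (leq_trans _ A_le) // [#|A|](cardsD1 x) xA (cardsD1 (u x) (A :\ x)) uxA; lia.
- move=> y; rewrite !inE => /and3P[yux yx yA]; rewrite uA // andbT; apply/andP; split.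
    by apply: contra yx => /eqP/(congr1 u); rewrite !uK // => ->.
  by apply: contra yux => /eqP e; rewrite -e uK.
- by move=> y; rewrite !inE => /and3P[_ _ /uK].
- by move=> y; rewrite !inE => /and3P[_ _ /ux].
Qed.

(** * The smallest face containing a vertex set *)

Section Closure.

Variable n : nat.
Notation T := (option ('I_n * bool)).
Implicit Types (S K : {set T}).

(** A face containing an antipodal pair contains the base, which explains the second branch. *)
Definition cl S : {set T} := if indep S then S else base n :|: S.

Lemma facial_cl S : facial (cl S).
Proof.
by rewrite /cl /facial; case: ifP => [->|_]; rewrite ?orbT // subsetUl.
Qed.

Lemma sub_cl S : S \subset cl S.
Proof. by rewrite /cl; case: ifP => // _; rewrite subsetUr. Qed.

Lemma cl_min S K : facial K -> S \subset K -> cl S \subset K.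
Proof.
move=> fK SK; rewrite /cl; case: ifP => // iS; rewrite subUset SK andbT.
by case/orP: fK => // /(indepS SK); rewrite iS.
Qed.

Lemma clS S S' : S \subset S' -> cl S \subset cl S'.
Proof. by move=> SS'; apply: cl_min (facial_cl _) (subset_trans SS' (sub_cl _)). Qed.

Lemma apex_cl S : (None \in cl S) = (None \in S).
Proof. by rewrite /cl; case: ifP; rewrite // !inE. Qed.

End Closure.

(** * The periodic word describing a zigzag, with its shifts and its reflection *)

Section Word.

Variable n : nat.
Hypothesis n_gt0 : 0 < n.
Notation T := (option ('I_n * bool)).

(** The sequence [v_k] extended to all indices by [v_{k+n} = - v_k]. *)
Definition vertex (k : nat) : 'I_n * bool :=
  (Ordinal (ltn_pmod k n_gt0), odd (k %/ n)).

(* [word] lists the vertices [x_{1,j}] of the zigzag of a flag starting at the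
   apex: the apex comes back every [n.+2] steps, and the other terms are
   [v_0, ..., v_{n-1}, - v_0, ..., - v_{n-1}] repeated cyclically. *)
Definition word (p : nat) : T :=
  if p %% n.+2 == 0 then None
  else Some (vertex ((p %/ n.+2) * n.+1 + (p %% n.+2).-1)).

Lemma word_spec c r : r < n.+2 ->
  word (c * n.+2 + r) = if r == 0 then None else Some (vertex (c * n.+1 + r.-1)).
Proof. by move=> r_lt; rewrite /word modnMDl divnMDl // modn_small // divn_small // addn0. Qed.

Lemma vertex_spec y x (x_lt : x < n) : vertex (y * n + x) = (Ordinal x_lt, odd y).
Proof.
rewrite /vertex; congr (_, _).
  by apply: val_inj; rewrite /= modnMDl modn_small.
by rewrite divnMDl // divn_small // addn0.
Qed.

Lemma vertex_shift k z : vertex (k + z * n) = ((vertex k).1, (vertex k).2 (+) odd z).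
Proof.
rewrite /vertex /=; congr (_, _); first by apply: val_inj; rewrite /= addnC modnMDl.
by rewrite addnC divnMDl // oddD addbC.
Qed.

Lemma vertex_fst_inj k m : 0 < m <= n -> (vertex k).1 = (vertex (k + m)).1 -> m = n.
Proof.
move=> m_le [/eqP]; rewrite -{1}[k]addn0 eqn_modDl mod0n eq_sym => m0.
by apply/eqP; rewrite eqn_leq; case/andP: m_le => m_gt -> /=; apply: dvdn_leq.
Qed.

(** Positions are converted to indices of [vertex]: [m] is the index difference, smaller than
    [q - p] exactly when an apex lies between. *)
Lemma word_pair p q : p < q < p + n.+2 -> word p != None -> word q != None ->
  exists k m, [/\ word p = Some (vertex k), word q = Some (vertex (k + m)), 0 < m <= n &
    (m < q - p) \/ (m = q - p /\ forall x, p <= x <= q -> word x != None)].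
Proof.
move: (divn_eq p n.+2) (ltn_pmod p (ltn0Sn n.+1)).
move: (p %/ n.+2) (p %% n.+2) => c r ep r_lt.
move: (divn_eq q n.+2) (ltn_pmod q (ltn0Sn n.+1)).
move: (q %/ n.+2) (q %% n.+2) => c' r' eq' r'_lt.
move=> pq; rewrite {1}ep {1}eq' !word_spec //; case: (eqVneq r 0) => // r0 _; case: (eqVneq r' 0) => // r'0 _.
(* The positions lie in the same block of length [n.+2] or in consecutive blocks; only the latter
   case has an apex between them. *)
have [ec|ec] : c' = c \/ c' = c.+1.
- have : c <= c' by rewrite leqNgt; apply/negP => cc'; have := leq_mul cc' (leqnn n.+2); nia.
  have : c' <= c.+1 by rewrite leqNgt; apply/negP => cc'; have := leq_mul cc' (leqnn n.+2); nia.
  by lia.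
- exists (c * n.+1 + r.-1), (r' - r); subst c' p q; rewrite !word_spec // (negPf r0) (negPf r'0).
  split=> //; [by congr (Some (vertex _)); lia|lia|right; split; first lia].
  move=> x x_le; have -> : x = c * n.+2 + (x - c * n.+2) by lia.
  by rewrite word_spec; [case: (eqVneq (x - c * n.+2) 0) => // x0; lia|lia].
- exists (c * n.+1 + r.-1), (n.+1 + r' - r); subst c' p q; rewrite !word_spec // (negPf r0) (negPf r'0).
  split=> //; [by congr (Some (vertex _)); lia|lia|left; lia].
Qed.

Lemma word_inj p q : p < q < p + n.+2 -> word p != word q.
Proof.
move=> pq; have [wp|wp] := eqVneq (word p) None; last first.
  have [->//|wq] := eqVneq (word q) None.
  have [k [m [-> -> m_le _]]] := word_pair pq wp wq.
  apply/eqP => /Some_inj e.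
  have mn := vertex_fst_inj m_le (congr1 fst e).
  by move: e; rewrite mn -[X in k + X]mul1n vertex_shift => /(congr1 snd) /=; case: odd.
rewrite wp; apply/eqP => /esym wq; move: wp wq; rewrite /word.
case: eqP => // p0 _; case: eqP => // q0 _.
have : n.+2 %| q - p by rewrite dvdn_subr ?(ltnW (andP pq).1) //; apply/eqP.
by move=> /dvdn_leq; lia.
Qed.

Definition window (i j : nat) : {set T} := [set t | t \in [seq word p | p <- iota j i]].

Lemma windowP i j t : reflect (exists2 p, j <= p < j + i & t = word p) (t \in window i j).
Proof.
rewrite inE; apply: (iffP mapP) => -[p]; rewrite ?mem_iota => p_in ->; exists p => //.
by rewrite mem_iota.
Qed.

Lemma card_window i j : i <= n.+2 -> #|window i j| = i.
Proof.
move=> i_le; rewrite cardsE (card_uniqP _) ?size_map ?size_iota //.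
rewrite map_inj_in_uniq ?iota_uniq // => p q; rewrite !mem_iota => p_in q_in wpq.
apply/eqP; rewrite eqn_leq; apply/andP; split; rewrite leqNgt; apply/negP => lt.
  by have := @word_inj q p; rewrite wpq eqxx => /(_ ltac:(lia)).
by have := @word_inj p q; rewrite wpq eqxx => /(_ ltac:(lia)).
Qed.

(** Antipodal letters have index difference [n], so they are more than [n] positions apart, or
    exactly [n] with no apex in between. *)
Lemma window_antipodal i j : i <= n.+2 -> ~~ indep (window i j) ->
  exists p q, [/\ j <= p, p < q, q < j + i &
    n < q - p \/ (n = q - p /\ forall x, p <= x <= q -> word x != None)].
Proof.
move=> i_le /forallPn[l]; rewrite negbK => /andP[/windowP[p p_in wp] /windowP[q q_in wq]].
have gap p' q' b b' : j <= p' < j + i -> j <= q' < j + i -> p' < q' ->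
    Some (l, b) = word p' -> Some (l, b') = word q' ->
    n < q' - p' \/ (n = q' - p' /\ forall x, p' <= x <= q' -> word x != None).
  move=> p'_in q'_in pq' wp' wq'.
  have pq'_lt : p' < q' < p' + n.+2 by lia.
  have [||k [m [ek em m_le]]] := word_pair pq'_lt; [by rewrite -wp'|by rewrite -wq'|].
  rewrite -wp' in ek; rewrite -wq' in em.
  suff -> : m = n by [].
  by have := @vertex_fst_inj k m m_le; rewrite -(Some_inj ek) -(Some_inj em); apply.
have [pq|pq|pq] := ltngtP p q.
- by exists p, q; split; [lia| |lia|apply: gap wp wq].
- by exists q, p; split; [lia| |lia|apply: gap wq wp].
- by move: wq; rewrite -pq -wp.
Qed.

(** The array of reversed flags in closed form: for the zigzag flag number [j], [x_{i,c}] is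
    [zface i (j + c - 1)]. *)
Definition zface (i j : nat) : {set T} := cl (window i j).

Lemma facial_zface i j : facial (zface i j).
Proof. exact: facial_cl. Qed.

Lemma apex_window j : None \in window n.+2 j.
Proof.
(* The multiple of [n.+2] among these [n.+2] consecutive positions. *)
apply/windowP; exists ((j + n.+1) %/ n.+2 * n.+2).
  have := divn_eq (j + n.+1) n.+2; have := ltn_pmod (j + n.+1) (ltn0Sn n.+1); lia.
by rewrite -[X in word X]addn0 word_spec.
Qed.

(** An independent window is counted directly. Otherwise its length is at least [n.+1]: at [n.+2] it
    contains the apex and its closure is everything; at [n.+1] its ends are antipodal, it has no
    apex, and its closure is the base. *)
Lemma rk_zface i j : i <= n.+2 -> rk (zface i j) = i.
Proof.
move=> i_le; rewrite /zface /cl; case: ifP => [iw|/negbT niw].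
  by rewrite rk_card // card_window.
have -> : rk (base n :|: window i j) = n.+1 + (None \in window i j).
  by rewrite /rk subsetUl !inE.
have [p [q [jp pq qi gap]]] := window_antipodal i_le niw.
move: i_le; rewrite leq_eqVlt => /orP[/eqP ei|i_lt]; first by rewrite ei apex_window addn1.
have ei : i = n.+1 by case: gap => [|[]]; lia.
case: gap => [|[np wN]]; first lia.
suff /negPf-> : None \notin window i j by rewrite ei addn0.
by apply/negP => /windowP[x x_in /esym/eqP]; apply/negP/wN; lia.
Qed.

Lemma zface0 j : zface 0 j = set0.
Proof.
have -> : zface 0 j = window 0 j.
  by rewrite /zface /cl (indepS _ (indep0 n)) //; apply/subsetP => t; rewrite inE.
by apply/setP => t; rewrite !inE.
Qed.

Lemma zfaceT j : zface n.+2 j = setT.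
Proof. by apply: rk_inj; rewrite ?facial_zface ?facialT ?subsetT // rkT rk_zface. Qed.

Lemma window_subL i j : window i j \subset window i.+1 j.
Proof. by apply/subsetP => t /windowP[p p_in ->]; apply/windowP; exists p => //; lia. Qed.

Lemma window_subR i j : window i j.+1 \subset window i.+1 j.
Proof. by apply/subsetP => t /windowP[p p_in ->]; apply/windowP; exists p => //; lia. Qed.

Lemma zface_subL i j : zface i j \subset zface i.+1 j.
Proof. exact/clS/window_subL. Qed.

Lemma zface_subR i j : zface i j.+1 \subset zface i.+1 j.
Proof. exact/clS/window_subR. Qed.

(** If the two faces agreed, both would contain the window of length [i.+1] at [j], whose closure
    has larger rank. *)
Lemma zface_neq i j : 0 < i <= n.+1 -> zface i j != zface i j.+1.
Proof.
move=> i_le; apply/eqP => exs.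
have : rk (zface i.+1 j) <= rk (zface i j).
  apply: rk_leq; rewrite ?facial_zface //; apply: cl_min; rewrite ?facial_zface //.
  apply/subsetP => t /windowP[p p_in ->].
  have [p_lt|p_ge] := ltnP p (j + i).
    by apply: (subsetP (sub_cl _)); apply/windowP; exists p => //; lia.
  by rewrite exs; apply: (subsetP (sub_cl _)); apply/windowP; exists p => //; lia.
by rewrite !rk_zface; lia.
Qed.

(** Position [n.+2] carries the apex and is preceded by [a] letters of the window. Hence the zigzag
    meets every orbit of flags. *)
Lemma apex_zface a r : a < n.+2 -> r <= n.+2 -> (None \in zface r (n.+2 - a)) = (a < r).
Proof.
move=> a_lt r_le; rewrite apex_cl; apply/windowP/idP => [[p p_in]|ar]; last first.
  by exists n.+2; [lia|rewrite /word modnn].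
rewrite /word; case: eqP => // p0 _; have := divn_eq p n.+2; rewrite p0 addn0.
by case: (p %/ n.+2) => [|[|c]]; nia.
Qed.

(** A run of [n] blocks contains [n * n.+1] base letters, that is [n.+1] runs through the axes, each
    changing the sign. *)
Lemma word_shift c p :
  word (p + c * n * n.+2) = signed_perm 1%g (fun _ => odd (c * n.+1)) (word p).
Proof.
rewrite (divn_eq p n.+2) -addnA [_ %% _ + _]addnC addnA -mulnDl.
have r_lt := ltn_pmod p (ltn0Sn n.+1); rewrite !word_spec //; case: eqP => // _.
rewrite mulnDl -mulnA [n * _]mulnC mulnA -addnA [c * _ * n + _]addnC addnA vertex_shift.
by rewrite /= perm1.
Qed.

Lemma flip_subproof : injective (fun i : 'I_n => Ordinal (ltn_pmod (n - i) n_gt0)).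
Proof.
move=> i j /(congr1 val) /= e; apply: val_inj => /=.
have flipE (k : 'I_n) : (n - k) %% n = if k == 0 :> nat then 0 else n - k.
  case: eqP => [->|k0]; first by rewrite subn0 modnn.
  by rewrite modn_small //; have := ltn_ord k; lia.
by move: e; rewrite !flipE; have := ltn_ord i; have := ltn_ord j; do 2!case: eqP; lia.
Qed.

(** Negation of the axes modulo [n]. Together with [flip_sign] it acts on indices of [vertex] modulo
    [2n] as [k -> n - k]. *)
Definition flip : {perm 'I_n} := perm flip_subproof.

Definition flip_sign (i : 'I_n) : bool := i == 0 :> nat.

Notation reflection := (signed_perm flip flip_sign).

Lemma vertex_reflection k : k <= (2 * n.+1).+1 * n ->
  Some (vertex ((2 * n.+1).+1 * n - k)) = reflection (Some (vertex k)).
Proof.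
rewrite (divn_eq k n); have x_lt := ltn_pmod k n_gt0; move: (k %/ n) (k %% n) x_lt => y x x_lt k_le.
have -> : reflection (Some (vertex (y * n + x))) =
    Some (Ordinal (ltn_pmod (n - x) n_gt0), odd y (+) (x == 0)).
  by rewrite (vertex_spec _ x_lt) /= permE.
have [x0|x0] := eqVneq x 0.
  have -> : (2 * n.+1).+1 * n - (y * n + x) = ((2 * n.+1).+1 - y) * n + 0.
    by rewrite x0 mulnBl; lia.
  have y_le : y <= (2 * n.+1).+1 by rewrite -(leq_pmul2r n_gt0); lia.
  rewrite (vertex_spec _ n_gt0); congr (Some (_, _)).
    by apply: val_inj; rewrite /= x0 subn0 modnn.
  by rewrite oddB // oddS oddM addbC.
have y_le : y <= 2 * n.+1.
  by rewrite leqNgt; apply/negP => y_gt; have := leq_mul y_gt (leqnn n); lia.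
have nx_lt : n - x < n by lia.
have -> : (2 * n.+1).+1 * n - (y * n + x) = (2 * n.+1 - y) * n + (n - x).
  by rewrite mulnBl; have := leq_mul y_le (leqnn n); lia.
rewrite (vertex_spec _ nx_lt); congr (Some (_, _)).
  by apply: val_inj; rewrite /= modn_small.
by rewrite oddB // oddM /= addbF.
Qed.

(** Mirroring positions preserves the multiples of [n.+2], and the [vertex] indices at mirrored
    positions have constant sum [(2n + 3) n], as [vertex_reflection] requires. *)
Lemma word_reflection p :
  p <= (2 * n).+1 * n.+2 -> word ((2 * n).+1 * n.+2 - p) = reflection (word p).
Proof.
rewrite (divn_eq p n.+2); have := ltn_pmod p (ltn0Sn n.+1).
move: (p %/ n.+2) (p %% n.+2) => c r r_lt p_le; rewrite [word (c * _ + r)]word_spec //.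
have [r0|r0] := eqVneq r 0.
  have -> : (2 * n).+1 * n.+2 - (c * n.+2 + r) = ((2 * n).+1 - c) * n.+2 + 0.
    by rewrite mulnBl; lia.
  by rewrite word_spec.
have c_le : c <= 2 * n.
  by rewrite leqNgt; apply/negP => c_gt; have := leq_mul c_gt (leqnn n.+2); lia.
have -> : (2 * n).+1 * n.+2 - (c * n.+2 + r) = (2 * n - c) * n.+2 + (n.+2 - r).
  by rewrite mulnBl; have := leq_mul c_le (leqnn n.+2); lia.
rewrite word_spec; last lia.
have /negPf-> : n.+2 - r != 0 by lia.
rewrite -vertex_reflection; last by have := leq_mul c_le (leqnn n.+1); nia.
by congr (Some (vertex _)); rewrite mulnBl; have := leq_mul c_le (leqnn n.+1); nia.
Qed.

Lemma reflectionK : involutive reflection.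
Proof.
case=> [[i b]|] //=; rewrite !permE /=; congr (Some (_, _)).
  apply: val_inj => /=; have := ltn_ord i; have [->|i0] := eqVneq (i : nat) 0.
    by rewrite subn0 modnn subn0 modnn.
  by move=> i_lt; rewrite (modn_small (_ : n - i < n)) ?modn_small //; lia.
rewrite /flip_sign /=; have := ltn_ord i; have [->|i0] := eqVneq (i : nat) 0.
  by rewrite subn0 modnn addbK.
move=> i_lt; rewrite modn_small; last lia.
have /negPf-> : n - i != 0 by lia.
by rewrite !addbF.
Qed.

Lemma reflection_fix t : odd n -> reflection t = t -> t = None.
Proof.
move=> n_odd; case: t => [[i b]|] //= [] ei; rewrite permE in ei.
move: ei => /(congr1 val) /=; rewrite /flip_sign; have := ltn_ord i.
have [->|i0] := eqVneq (i : nat) 0; first by case: b.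
move=> i_lt; rewrite modn_small; last lia.
move=> e; have e' : n = (i : nat).*2 by lia.
by rewrite e' odd_double in n_odd.
Qed.

End Word.

(** * The operators on flags, computed along the zigzag *)

Section PyramidZigzags.

Variables (R : realFieldType) (n : nat).
Hypothesis n_gt1 : 1 < n.
Let n_gt0 : 0 < n := ltnW n_gt1.
Notation T := (option ('I_n * bool)).
Notation Pyr := (pyramid (@cross_polytope R n)).
Notation face := (face Pyr).
Notation d := n.+1.
Notation flag := (d.-tuple face).
Notation act g f := (('P * d)%act f g).
Notation sym := (symmetry_group Pyr).
Implicit Types (F G : face) (f : flag) (S : {set T}) (g : {perm face}).

Lemma flag_subset f i j :
  f \in flags Pyr d -> i <= j -> j <= d.+1 -> flag_face f i \subset flag_face f j.
Proof.
move=> ff; elim: j => [|j IH]; first by rewrite leqn0 => /eqP->.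
rewrite leq_eqVlt => /orP[/eqP->//|ij] j_le.
by apply: subset_trans (IH ij (ltnW j_le)) (proper_sub (flag_facial_proper n_gt1 ff _)).
Qed.

(** Reduces every computation of [sigma] to exhibiting a flag that differs at rank [i] only:
    whatever face [pick] returns is the right one by [diamond]. *)
Lemma sigma_eq f f' i :
    f \in flags Pyr d -> f' \in flags Pyr d -> 0 < i <= d ->
    (forall k, k <= d.+1 -> k != i -> flag_face f k = flag_face f' k) ->
    flag_face f i != flag_face f' i ->
  sigma i f = f'.
Proof.
move=> ff ff' i_in eq_ff' neq_i; apply: eq_from_tnth => k; rewrite tnth_mktuple.
case: eqP => [ki|/eqP ki]; last first.
  by apply: val_inj; rewrite /= -!flag_faceS eq_ff' // ltnS ltnW.
have eL : flag_face f i.-1 = flag_face f' i.-1 by apply: eq_ff'; lia.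
have eU : flag_face f i.+1 = flag_face f' i.+1 by apply: eq_ff'; lia.
have Fk : val (tnth f k) = flag_face f i by rewrite -flag_faceS ki.
have Fk' : val (tnth f' k) = flag_face f' i by rewrite -flag_faceS ki.
have rkG G : flag_face f i.-1 \proper val G -> val G \proper flag_face f i.+1 -> rk (val G) = i.
  move=> LG GU; have := rk_ltn (flag_face_facial f (_ : i.-1 <= d.+1)) (face_facial G) LG.
  have := rk_ltn (face_facial G) (flag_face_facial f (_ : i.+1 <= d.+1)) GU.
  by rewrite !rk_flag //; lia.
case: pickP => [G /and3P[GF LG GU]|/(_ (tnth f' k))/negbT/negP[]].
  apply: val_inj => /=; rewrite Fk'.
  have i1_le : i.-1 <= d.+1 by lia.
  have i2_le : i.+1 <= d.+1 by lia.
  have i_le : i <= d.+1 by lia.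
  apply: (diamond (L := flag_face f i.-1) (U := flag_face f i.+1) (F := flag_face f i));
    rewrite ?flag_face_facial ?face_facial ?rk_flag ?rkG ?(proper_sub LG) ?(proper_sub GU) //; try lia.
  - by apply: flag_subset; rewrite ?leq_pred.
  - by apply: flag_subset.
  - by rewrite eL; apply: flag_subset; rewrite ?leq_pred.
  - by rewrite eU; apply: flag_subset.
  - by rewrite -Fk (inj_eq val_inj).
  - by rewrite eq_sym.
apply/and3P; split.
- by rewrite -(inj_eq val_inj) Fk Fk' eq_sym.
- rewrite Fk' eL -{2}[i]prednK; last lia.
  by apply: flag_facial_proper; rewrite //; lia.
- by rewrite Fk' eU; apply: flag_facial_proper; rewrite //; lia.
Qed.

Lemma flag_small f i : f \in flags Pyr d -> i <= n -> indep (flag_face f i).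
Proof.
move=> ff i_le; have i_le' : i <= d.+1 by lia.
by apply: rk_small; rewrite ?flag_face_facial // rk_flag.
Qed.

Lemma card_flag_small f i : f \in flags Pyr d -> i <= n -> #|flag_face f i| = i.
Proof.
by move=> ff i_le; rewrite -rk_card ?flag_small // rk_flag //; lia.
Qed.

(** Edges have two vertices, so [sigma 1] replaces the vertex by the other end of the edge. *)
Lemma sigma1P f : f \in flags Pyr d ->
  [/\ sigma 1 f \in flags Pyr d,
      forall k, k <= d.+1 -> k != 1 -> flag_face f k = flag_face (sigma 1 f) k &
      flag_face f 1 != flag_face (sigma 1 f) 1].
Proof.
move=> ff; pose D := flag_face f 2 :\: flag_face f 1.
have F12 : flag_face f 1 \subset flag_face f 2 by apply: flag_subset.
have cD : #|D| = 1.
  by rewrite cardsD (setIidPr F12) !card_flag_small.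
have D0 : D != set0 by rewrite -card_gt0 cD.
pose x i := if i == 1 then D else flag_face f i.
have fx r : r <= d.+1 -> facial (x r).
  rewrite /x; case: eqP => _ r_le; last exact: flag_face_facial.
  by rewrite /facial (indepS (subsetDl _ _)) ?orbT // flag_small.
have x0 : x 0 = set0 by [].
have xT : x d.+1 = setT by rewrite /x flag_faceT.
have xF : mkflag R x \in flags Pyr d.
  apply: mkflag_flags => // -[|[|r]] r_le; rewrite /x /=.
  - by rewrite proper0.
  - rewrite properEcard subsetDl cD card_flag_small //.
  - exact: flag_facial_proper.
have xk k : k <= d.+1 -> k != 1 -> flag_face f k = flag_face (mkflag R x) k.
  by move=> k_le /negPf k1; rewrite flag_face_mkflag // /x k1.
have x1 : flag_face f 1 != flag_face (mkflag R x) 1.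
  rewrite flag_face_mkflag // /x /=; have [t tD] := set0Pn _ D0.
  by apply/eqP => e; move: (tD); rewrite inE e tD.
by have -> : sigma 1 f = mkflag R x by apply: sigma_eq.
Qed.

Lemma sigma1K f : f \in flags Pyr d -> sigma 1 (sigma 1 f) = f.
Proof.
move=> ff; have [sf eq_f neq_f] := sigma1P ff.
by apply: sigma_eq => // [k k_le k1|]; rewrite 1?eq_sym // eq_f.
Qed.

Lemma sigma1_neq f : f \in flags Pyr d -> sigma 1 f != f.
Proof.
by move=> ff; have [_ _] := sigma1P ff; apply: contraNneq => ->.
Qed.

Lemma sigma1_act g f :
  g \in sym -> f \in flags Pyr d -> sigma 1 (act g f) = act g (sigma 1 f).
Proof.
move=> g_aut ff; have [sf eq_f neq_f] := sigma1P ff.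
apply: sigma_eq; [exact: act_flags|exact: act_flags|by []|move=> k k_le k1|].
  by rewrite !flag_face_act // eq_f.
rewrite !flag_face_act // (inj_eq val_inj) (inj_eq perm_inj).
by rewrite -(inj_eq val_inj) !val_mkface ?flag_face_facial.
Qed.

Definition zflag (j : nat) : flag := mkflag R (fun i => zface n_gt0 i j).

Lemma rank_chain_proper (x : nat -> {set T}) i :
    (forall r, r <= d.+1 -> facial (x r)) -> (forall r, r <= d.+1 -> rk (x r) = r) ->
  i <= d -> x i \subset x i.+1 -> x i \proper x i.+1.
Proof.
move=> fx rx i_le sx; rewrite properEneq sx andbT; apply/eqP => /(congr1 (@rk n)).
by rewrite !rx //; lia.
Qed.

(** The state after the first [m] of the involutions composing [Tstep]: ranks up to [m] have
    advanced to [j.+1]. *)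
Definition zmixed (m j i : nat) : {set T} := zface n_gt0 i (if i <= m then j.+1 else j).

Lemma rk_zmixed m j r : r <= d.+1 -> rk (zmixed m j r) = r.
Proof. by move=> r_le; rewrite rk_zface. Qed.

Lemma zmixed_flags m j : m <= d -> mkflag R (zmixed m j) \in flags Pyr d.
Proof.
move=> m_le; apply: mkflag_flags => [||||r r_le]; rewrite /zmixed ?zface0 ?zfaceT //.
  by move=> r _; apply: facial_zface.
apply: (rank_chain_proper (x := zmixed m j)) => // [q q_le|q q_le|].
- exact: facial_zface.
- exact: rk_zmixed.
rewrite /zmixed; have [rm|rm] := leqP r.+1 m; first by rewrite ltnW // zface_subL.
by case: ifP => _; [apply: zface_subR|apply: zface_subL].
Qed.

Lemma flag_face_zmixed m j i :
  i <= d.+1 -> flag_face (mkflag R (zmixed m j)) i = zmixed m j i.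
Proof.
apply: flag_face_mkflag; rewrite /zmixed ?zface0 ?zfaceT //.
by move=> r _; apply: facial_zface.
Qed.

Lemma zmixed0 j : mkflag R (zmixed 0 j) = zflag j.
Proof.
apply: eq_from_tnth => k; by rewrite !tnth_mktuple.
Qed.

Lemma zmixed_max j : mkflag R (zmixed d j) = zflag j.+1.
Proof. by apply: eq_from_tnth => k; rewrite !tnth_mktuple /zmixed ltn_ord. Qed.

Lemma zflag_flags j : zflag j \in flags Pyr d.
Proof. by rewrite -zmixed0; apply: zmixed_flags. Qed.

Lemma flag_face_zflag j i : i <= d.+1 -> flag_face (zflag j) i = zface n_gt0 i j.
Proof.
move=> i_le; rewrite -zmixed0 flag_face_zmixed // /zmixed.
by case: i {i_le} => [|i]; rewrite // !zface0.
Qed.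

Lemma Tstep_zflag g j : g \in sym -> Tstep (act g (zflag j)) = act g (zflag j.+1).
Proof.
move=> g_aut; rewrite /Tstep -zmixed0 -zmixed_max.
suff: forall m, m <= d ->
    foldl (fun f i => sigma i f) (act g (mkflag R (zmixed 0 j))) (iota 1 m) =
    act g (mkflag R (zmixed m j)) by apply.
elim=> // m IH m_lt; have -> : iota 1 m.+1 = iota 1 m ++ [:: m.+1] by rewrite -(addn1 m) iotaD add1n addn1.
rewrite foldl_cat IH ?(ltnW m_lt) //=; apply: sigma_eq => // [||k k_le km|].
- by apply: act_flags; rewrite // zmixed_flags // ltnW.
- by apply: act_flags; rewrite // zmixed_flags.
  rewrite !flag_face_act // !flag_face_zmixed // /zmixed.
  by have -> : (k <= m.+1) = (k <= m) by lia.
have m_le : m.+1 <= d.+1 by lia.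
rewrite !flag_face_act // (inj_eq val_inj) (inj_eq perm_inj).
rewrite -(inj_eq val_inj) !val_mkface ?flag_face_facial // !flag_face_zmixed //.
by rewrite /zmixed ltnn leqnn zface_neq //; lia.
Qed.

Lemma iter_Tstep_zflag g j k :
  g \in sym -> iter k (@Tstep _ _ _ _ d) (act g (zflag j)) = act g (zflag (j + k)).
Proof.
move=> g_aut; elim: k => [|k IH]; first by rewrite addn0.
by rewrite iterS IH Tstep_zflag //; congr (act g (zflag _)); rewrite addnS.
Qed.

(** Each column is determined by the previous one, going upwards: [x_{i+1,j+1}] is the face other
    than [x_{i+1,j}] between [x_{i,j+1}] and [x_{i+2,j}]. *)
Lemma reverse_array_uniq f x y : f \in flags Pyr d ->
    reverse_array f x -> reverse_array f y ->
  forall i j, in_range d i j -> x i j = y i j.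
Proof.
move=> ff [x1 xd xL xR xn] [y1 yd yL yR yn] i j; elim: j i => [|j IHj] i.
  by rewrite /in_range andbF.
have rkx (z : nat -> nat -> face) : (forall i j, in_range d i j -> face_dim_eq (z i j) i.-1) ->
    forall i j, in_range d i j -> rk (val (z i j)) = i.
  move=> zd k l kl; have := zd _ _ kl; rewrite face_dim_rk // => /eqP->.
  by case/and3P: kl; lia.
have [->|j0] := eqVneq j 0.
  move=> r; have i_in : i.-1 < d by move: r; rewrite /in_range; lia.
  have -> : i = (Ordinal i_in).+1 by move: r; rewrite /in_range /=; lia.
  by rewrite x1 y1.
elim: i => [|i IHi] r; first by rewrite /in_range in r.
have rF : in_range d i.+1 j by move: r; rewrite /in_range; lia.
have rU : in_range d i.+2 j by move: r; rewrite /in_range; lia.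
(* The array starts at [i = 1], so the empty face stands in for row 0. *)
pose L : {set T} := if i == 0 then set0 else val (x i j.+1).
have rL : i != 0 -> in_range d i j.+1 by move: r; rewrite /in_range; lia.
have fL : facial L by rewrite /L; case: ifP => _; rewrite ?facial0 ?face_facial.
have rkL : rk L = i.
  rewrite /L; have [->|i0] := eqVneq i 0; first exact: rk0.
  by rewrite (rkx x) ?rL.
have Lsub (S : {set T}) : (i != 0 -> val (x i j.+1) \subset S) -> L \subset S.
  by rewrite /L; case: eqVneq => [_ _|_ ->]; rewrite ?sub0set.
apply: val_inj.
apply: (diamond (L := L) (U := val (x i.+2 j)) (F := val (x i.+1 j)));
  rewrite ?face_facial ?rkL ?(rkx x) ?(rkx y) //.
- by apply: Lsub => i0; apply: xR; rewrite ?rL.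
- exact: xL.
- by apply: Lsub => i0; apply: xL; rewrite ?rL.
- exact: (xR i.+1 j.+1).
- by apply: Lsub => i0; rewrite IHi ?rL //; apply: yL; rewrite ?rL.
- by rewrite IHj //; apply: (yR i.+1 j.+1).
- by rewrite (inj_eq val_inj); apply/eqP; apply: (xn i.+1 j.+1).
- by rewrite (inj_eq val_inj) IHj //; apply/eqP; apply: (yn i.+1 j.+1).
Qed.

(** On the antidiagonal [c = d + 1 - i] the windows of the array all end at the same position. *)
Lemma flag_reverse_zflag g j : g \in sym ->
  flag_reverse (act g (zflag j)) = act g (mkflag R (fun i => zface n_gt0 i (j + d - i))).
Proof.
move=> g_aut.
pose x i c : face := g (mkface R (zface n_gt0 i (j + c.-1))).
have vx i c : val (mkface R (zface n_gt0 i c)) = zface n_gt0 i c.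
  by rewrite val_mkface // facial_zface.
have ff : act g (zflag j) \in flags Pyr d by rewrite act_flags ?zflag_flags.
have rx : reverse_array (act g (zflag j)) x.
  split=> [k|i c|i c r r'|i c r r'|i c r r'].
  - by rewrite tnth_act tnth_mktuple /x addn0.
  - rewrite /in_range => r; rewrite face_dim_rk // aut_rk // vx rk_zface //; lia.
  - by rewrite aut_subset // !vx zface_subL.
  - rewrite aut_subset // !vx; case: c r r' => [|[|c]]; rewrite /in_range; try lia.
    by move=> _ _; rewrite /= addnS zface_subR.
  - move/perm_inj/(congr1 val); rewrite !vx; case: c r r' => [|[|c]]; rewrite /in_range; try lia.
    move=> r _; rewrite /= addnS => /esym/eqP; apply/negP/zface_neq; lia.
have tx k : tnth (act g (mkflag R (fun i => zface n_gt0 i (j + d - i)))) k = x k.+1 (d - k).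
  rewrite tnth_act tnth_mktuple /x; congr (g (mkface R (zface n_gt0 _ _))).
  by have := ltn_ord k; lia.
set f' := act g (mkflag _ _) in tx *; rewrite /flag_reverse.
case: pickP => [f /asboolP[y ry fy]|/(_ f')/negbT/asboolPn[]].
  apply: eq_from_tnth => k; rewrite /= fy tx; apply: (reverse_array_uniq ff ry rx).
  by have := ltn_ord k; rewrite /in_range; lia.
by exists x.
Qed.

End PyramidZigzags.

(** * Periodicity, transport of zigzags by symmetries, and signatures *)

Section ZUniformity.

Variables (R : realFieldType) (n : nat).
Hypothesis n_gt1 : 1 < n.
Let n_gt0 : 0 < n := ltnW n_gt1.
Notation T := (option ('I_n * bool)).
Notation Pyr := (pyramid (@cross_polytope R n)).
Notation face := (face Pyr).
Notation d := n.+1.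
Notation flag := (d.-tuple face).
Notation act g f := (('P * d)%act f g).
Notation sym := (symmetry_group Pyr).
Notation zflag := (zflag R n_gt1).
Notation saut := (signed_aut R).
Implicit Types (F G : face) (f : flag) (S : {set T}) (g : {perm face}).

Lemma zface_signed_perm s e i j k : i <= n.+2 ->
    window n_gt0 i k = signed_perm s e @: window n_gt0 i j ->
  zface n_gt0 i k = signed_perm s e @: zface n_gt0 i j.
Proof.
move=> i_le wE; have fx := facial_zface n_gt0 i j.
apply: rk_inj; rewrite ?facial_zface ?facial_signed_perm //.
  by apply: cl_min; rewrite ?facial_signed_perm // wE imsetS // sub_cl.
have := aut_rk n_gt1 (mkface R (zface n_gt0 i j)) (signed_autP R s e).
by rewrite val_signed_aut val_mkface // => ->; rewrite !rk_zface.
Qed.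

Lemma act_signed_aut s e (x y : nat -> {set T}) :
    (forall i, i <= n.+1 -> facial (x i)) ->
    (forall i, i <= n.+1 -> y i = signed_perm s e @: x i) ->
  act (saut s e) (mkflag R x) = mkflag R y.
Proof.
move=> fx xy; apply: eq_from_tnth => k; apply: val_inj.
rewrite tnth_act val_signed_aut !tnth_mktuple xy ?val_mkface ?facial_signed_perm ?fx //.
Qed.

(** After this many letters the word repeats, up to the central symmetry when [n] is even. Doubling
    it gives a period for both parities. *)
Definition half_period : nat := n * n.+2.
Definition period : nat := 2 * half_period.

Lemma zflag_shift c j :
  zflag (j + c * half_period) = act (saut 1%g (fun _ => odd (c * n.+1))) (zflag j).
Proof.
apply/esym/act_signed_aut => i i_le; first exact: facial_zface.
apply: zface_signed_perm; first exact: leqW.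
apply/setP => t; apply/windowP/imsetP => [[p p_in ->]|[u /windowP[p p_in ->] ->]].
  exists (word n_gt0 (p - c * half_period)); last first.
    by rewrite -word_shift -mulnA subnK //; lia.
  by apply/windowP; exists (p - c * half_period) => //; lia.
exists (p + c * half_period); first lia.
by rewrite -word_shift mulnA.
Qed.

Lemma act_id g f : (forall F, g F = F) -> act g f = f.
Proof. by move=> gF; apply: eq_from_tnth => k; rewrite tnth_act. Qed.

Lemma zflag_period c j : zflag (j + c * period) = zflag j.
Proof.
rewrite /period mulnA zflag_shift act_id // => F; apply: val_inj.
rewrite val_signed_aut -mulnA mulnC -mulnA mul2n odd_double.
rewrite -[RHS]imset_id; apply: eq_imset => -[[i b]|] //=.
by rewrite perm1 addbF.
Qed.

Lemma period_gt0 : 0 < period.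
Proof. by rewrite /period /half_period !muln_gt0 n_gt0. Qed.

Lemma zflag_mod j : zflag j = zflag (j %% period).
Proof.
rewrite -(zflag_period (j %/ period) (j %% period)).
by congr zflag; rewrite addnC -divn_eq.
Qed.

(** The reference zigzag as a set, so that [period] may be a proper multiple of its length. *)
Definition zflags : {set flag} := [set zflag (val j) | j : 'I_period].

Lemma mem_zflags j : zflag j \in zflags.
Proof.
rewrite zflag_mod; apply/imsetP.
by exists (Ordinal (ltn_pmod j period_gt0)).
Qed.

Lemma zflagsP f : f \in zflags -> exists2 j, j < period & f = zflag j.
Proof. by case/imsetP => j _ ->; exists (val j) => //; apply: ltn_ord. Qed.

Lemma zflags_sub f : f \in zflags -> f \in flags Pyr d.
Proof. by case/zflagsP => j _ ->; apply: zflag_flags. Qed.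

Notation refl_aut := (saut (flip n_gt0) (@flip_sign n)).

(** The reflection turns windows with a common end into windows with a common start; the mirror
    centre sends that end to [period + 2 - j]. *)
Lemma zflag_reflection j : j <= period + 2 ->
  mkflag R (fun i => zface n_gt0 i (j + d - i)) = act refl_aut (zflag (period + 2 - j)).
Proof.
move=> j_le; apply/esym/act_signed_aut => i i_le; first exact: facial_zface.
apply: zface_signed_perm; first exact: leqW.
have eM : (2 * n).+1 * n.+2 = period + n.+2 by rewrite /period /half_period; lia.
apply/setP => t; apply/windowP/imsetP => [[p p_in ->]|[u /windowP[p p_in ->] ->]].
  exists (word n_gt0 ((2 * n).+1 * n.+2 - p)); last first.
    by rewrite -word_reflection ?leq_subr // subKn //; lia.
  by apply/windowP; exists ((2 * n).+1 * n.+2 - p) => //; lia.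
exists ((2 * n).+1 * n.+2 - p); first lia.
by rewrite -word_reflection //; lia.
Qed.

(** The zigzag flag starting at [n.+2 - a] has the same apex step as [f], hence lies in its
    orbit. *)
Lemma flag_on_zigzag f : f \in flags Pyr d ->
  exists g j, g \in sym /\ f = act g (zflag j).
Proof.
move=> /(flags_std n_gt1)[a [s [e ->]]].
have /(flags_std n_gt1)[a' [s' [e' eX]]] := zflag_flags R n_gt1 (n.+2 - a).
have aa' : a' = a.
  have h r : r <= n.+2 -> (a' < r) = (a < r).
    move=> r_le; rewrite -(apex_zface n_gt0 (ltn_ord a) r_le) -(flag_face_zflag R n_gt1) //.
    by rewrite eX flag_face_std // inE.
  apply: val_inj => /=; have := h a; have := h a'.
  by have := ltn_ord a; have := ltn_ord a'; lia.
subst a'; exists (saut (s' * s^-1)%g (fun i => e' i (+) e ((s' * s^-1)%g i))), (n.+2 - a).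
by split; [apply: signed_autP|rewrite eX std_flag_act].
Qed.

Lemma act_flag_inj g : injective (fun f : flag => act g f).
Proof. exact: act_inj. Qed.

Lemma zigzagE (Z : seq flag) : is_zigzag Z ->
  exists2 g, g \in sym & Z =i [set act g f | f in zflags].
Proof.
case=> Z0 ZF uZ cZ; have [f fZ] : exists f, f \in Z.
  by case: Z Z0 {ZF uZ cZ} => // f Z _; exists f; rewrite mem_head.
have [g [j [g_aut ef]]] := flag_on_zigzag (ZF f fZ); exists g => // y.
rewrite -(fconnect_cycle cZ fZ); apply/idP/imsetP => [/iter_findex <-|[_ /zflagsP[k k_lt ->] ->]].
  exists (zflag (j + findex (@Tstep _ _ _ Pyr d) f y)); first exact: mem_zflags.
  by rewrite {2}ef iter_Tstep_zflag.
(* Adding [j] periods allows reaching index [k] from [j] by going forwards only. *)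
have -> : act g (zflag k) = iter (k + j * period - j) (@Tstep _ _ _ Pyr d) f.
  rewrite ef iter_Tstep_zflag // subnKC ?zflag_period //.
  by rewrite (leq_trans (leq_pmulr j period_gt0)) // leq_addl.
exact: fconnect_iter.
Qed.

(** Transports the counts defining the signature to the reference zigzag, where they no longer
    depend on [Z]. *)
Lemma count_zigzag (Z : seq flag) g (a b : pred flag) :
    uniq Z -> Z =i [set act g f | f in zflags] ->
    (forall f, f \in zflags -> a (act g f) = b f) ->
  count a Z = #|[set f in zflags | b f]|.
Proof.
move=> uZ ZE ab; rewrite -size_filter -(card_uniqP (filter_uniq a uZ)).
rewrite -[RHS](card_imset _ (@act_flag_inj g)); apply: eq_card => y; rewrite mem_filter ZE.
apply/andP/imsetP => [[ay /imsetP[f fz ey]]|[f]].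
  by exists f; rewrite // inE fz -ab // -ey.
by rewrite inE => /andP[fz bf] ->; rewrite ab //; split=> //; apply: imset_f.
Qed.

Lemma zigzag_reverseE (Z : seq flag) g :
    g \in sym -> Z =i [set act g f | f in zflags] ->
  zigzag_reverse Z =i [set act g (act refl_aut f) | f in zflags].
Proof.
move=> g_aut ZE y; rewrite mem_rev; apply/mapP/imsetP => [[f]|[f /zflagsP[j j_lt ->] ->]].
  rewrite ZE => /imsetP[_ /zflagsP[j j_lt ->] ->] ->.
  exists (zflag (period + 2 - j)); first exact: mem_zflags.
  by rewrite flag_reverse_zflag // zflag_reflection //; lia.
exists (act g (zflag (period + 2 - j))); first by rewrite ZE; apply/imset_f/mem_zflags.
rewrite flag_reverse_zflag // zflag_reflection; last lia.
by rewrite subKn //; lia.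
Qed.

Lemma signed_perm_commute s e s' e' f :
    (forall t, signed_perm s e (signed_perm s' e' t) = signed_perm s' e' (signed_perm s e t)) ->
  act (saut s e) (act (saut s' e') f) = act (saut s' e') (act (saut s e) f).
Proof.
move=> c; apply: eq_from_tnth => k; apply: val_inj.
by rewrite !tnth_act !val_signed_aut -!imset_comp; apply: eq_imset => t /=.
Qed.

Lemma act_reflK : involutive (fun f : flag => act refl_aut f).
Proof.
move=> f; apply: eq_from_tnth => k; apply: val_inj.
rewrite !tnth_act !val_signed_aut -imset_comp -[RHS]imset_id.
by apply: eq_imset => t /=; apply: reflectionK.
Qed.

Notation minus_aut := (saut 1%g (fun _ : 'I_n => true)).

Lemma act_minusK : involutive (fun f : flag => act minus_aut f).
Proof.
move=> f; apply: eq_from_tnth => k; apply: val_inj.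
rewrite !tnth_act !val_signed_aut -imset_comp -[RHS]imset_id.
by apply: eq_imset => -[[i b]|] //=; rewrite !perm1 addbK.
Qed.

(** An edge contains some base vertex but not its antipode, so the central symmetry moves it. *)
Lemma act_minus_neq f : f \in flags Pyr d -> act minus_aut f != f.
Proof.
move=> ff; apply/eqP => e.
have : flag_face (act minus_aut f) 2 = flag_face f 2 by rewrite e.
rewrite flag_face_act ?signed_autP // val_signed_aut val_mkface ?flag_face_facial // => e2.
have [i [b ib]] : exists i b, Some (i, b) \in flag_face f 2.
  have : ~~ (flag_face f 2 \subset [set None]).
    by apply: contraL isT => /subset_leq_card; rewrite card_flag_small // cards1.
  by case/subsetPn => -[[i b]|]; rewrite !inE // => ib _; exists i, b.
have := flag_small n_gt1 ff n_gt1 => /indepP/(_ _ _ ib)/negP; apply.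
rewrite -e2; apply/imsetP; exists (Some (i, b)) => //=.
by rewrite perm1 addbT.
Qed.

(* For odd [n] the reflection moves every base vertex. If it fixed the faces of
   ranks 2, 3 and 4 of a flag, the apex would have to be added at both steps. *)
Lemma act_refl_sigma1_neq f :
  odd n -> f \in flags Pyr d -> act refl_aut (sigma 1 f) != f.
Proof.
move=> n_odd ff; apply/eqP => e; have n_gt2 : 2 < n by case: n n_gt1 n_odd => [|[|[|]]].
have [sf eq_f _] := sigma1P n_gt1 ff.
have fixedF k : 1 < k <= d.+1 -> signed_perm (flip n_gt0) (@flip_sign n) @: flag_face f k = flag_face f k.
  move=> k_in; rewrite -[RHS]/(flag_face f k) -[in RHS]e flag_face_act ?signed_autP //; last lia.
  rewrite val_signed_aut val_mkface ?flag_face_facial //; last lia.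
  by rewrite eq_f //; lia.
have new_apex k : 1 < k -> k <= d -> #|flag_face f k.+1 :\: flag_face f k| = 1 ->
    None \in flag_face f k.+1 :\: flag_face f k.
  move=> k_gt k_le /eqP/cards1P[t Dt].
  suff -> : None = t by rewrite Dt set11.
  apply/esym/(@reflection_fix _ n_gt0 _ n_odd)/set1P; rewrite -Dt.
  have : t \in flag_face f k.+1 :\: flag_face f k by rewrite Dt set11.
  rewrite !inE => /andP[tk tk1]; have refl_inj := can_inj (signed_permK (flip n_gt0) (@flip_sign n)).
  rewrite -(fixedF k) ?(mem_imset _ _ refl_inj) ?tk /=; try lia.
  by rewrite -(fixedF k.+1) ?(mem_imset _ _ refl_inj) //; lia.
have sub k : k < d.+1 -> flag_face f k \subset flag_face f k.+1.
  by move=> k_lt; apply: flag_subset.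
have c k : k < n -> #|flag_face f k.+1 :\: flag_face f k| = 1.
  move=> k_lt; rewrite cardsD (setIidPr (sub k _)) ?card_flag_small //; try lia.
have /setDP[N3 _] : None \in flag_face f 3 :\: flag_face f 2 by apply: new_apex; rewrite ?c //; lia.
have N4 : None \in flag_face f 4 by apply: subsetP N3; apply: sub; lia.
suff /setDP[_] : None \in flag_face f 4 :\: flag_face f 3 by rewrite N3.
have c4 : #|flag_face f 4| = 4.
  have : rk (flag_face f 4) = 4 by apply: rk_flag => //; lia.
  by rewrite /rk N4; case: ifP => _ //; lia.
by apply: new_apex => //; rewrite cardsD (setIidPr (sub 3 _)) ?c4 ?card_flag_small //; lia.
Qed.

Lemma z_uniform_pyramid : z_uniform Pyr d.
Proof.
(* [S1] and [S2] are the counts [2 n_I] and [2 n_II] on the reference zigzag; they must be shown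
   even before being halved. *)
pose S1 := [set f in zflags | sigma 1 f \in zflags].
pose S2 := [set f in zflags | sigma 1 f \in [set act refl_aut f' | f' in zflags]].
have even1 : ~~ odd #|S1|.
  apply: (@even_card_involution _ _ (@sigma _ _ _ Pyr d 1)) => f; rewrite !inE => /andP[fz sfz].
  - by rewrite sfz sigma1K // zflags_sub.
  - by rewrite sigma1K // zflags_sub.
  - by rewrite sigma1_neq // zflags_sub.
have even2 : ~~ odd #|S2|.
  have [n_odd|n_even] := boolP (odd n).
    (* The flags [f] and [f'] are exchanged by [sigma 1] followed by the reflection, two commuting
       involutions. *)
    have S2P f : f \in S2 ->
        exists f', [/\ f \in zflags, f' \in zflags, act refl_aut (sigma 1 f) = f' &
                        sigma 1 f' = act refl_aut f].
      rewrite inE => /andP[fz /imsetP[f' fz' sf]]; have ff := zflags_sub fz.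
      have ef : act refl_aut (sigma 1 f) = f' by rewrite sf act_reflK.
      have [sff _ _] := sigma1P n_gt1 ff.
      by exists f'; split=> //; rewrite -ef sigma1_act ?signed_autP ?sigma1K.
    apply: (@even_card_involution _ _ (fun f => act refl_aut (sigma 1 f))) => f /S2P[f' [fz fz' ef sf']].
    - by rewrite ef inE fz' sf'; apply: imset_f.
    - by rewrite ef sf' act_reflK.
    - by apply: act_refl_sigma1_neq; rewrite ?zflags_sub.
  (* For even [n] the central symmetry is the shift by half a period, so it preserves the reference
     zigzag. *)
  have minus_zz f : f \in zflags -> act minus_aut f \in zflags.
    case/zflagsP => j _ ->; have := zflag_shift 1 j; rewrite !mul1n oddS n_even => <-.
    exact: mem_zflags.
  apply: (@even_card_involution _ _ (fun f => act minus_aut f)) => f;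
    rewrite !inE => /andP[fz /imsetP[f' fz' sf]].
  - rewrite minus_zz // sigma1_act ?signed_autP ?zflags_sub // sf signed_perm_commute.
      by apply: imset_f; apply: minus_zz.
    by case=> [[i b]|] //=; rewrite !perm1 -!addbA [true (+) _]addbC.
  - exact: act_minusK.
  - by rewrite act_minus_neq // zflags_sub.
exists #|zflags|, (#|S1|./2, #|S2|./2) => Z zZ; have [_ _ uZ _] := zZ.
have [g g_aut ZE] := zigzagE zZ.
split; first by rewrite -(card_uniqP uZ) (eq_card ZE) card_imset //; apply: act_flag_inj.
have half_even k : ~~ odd k -> 2 * k./2 = k by move=> k_even; rewrite mul2n halfK (negPf k_even) subn0.
rewrite /has_signature /= !half_even //; split; apply/esym/(count_zigzag uZ ZE) => f fz /=.
  rewrite sigma1_act ?zflags_sub // ZE.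
  by rewrite (mem_imset _ _ (@act_flag_inj g)).
rewrite sigma1_act ?zflags_sub // (zigzag_reverseE g_aut ZE).
rewrite (_ : [set act g (act refl_aut f0) | f0 in zflags] =
  [set act g f0 | f0 in [set act refl_aut f' | f' in zflags]]).
  by rewrite (mem_imset _ _ (@act_flag_inj g)).
apply/setP => y; apply/imsetP/imsetP => [[f1 f1z ->]|[_ /imsetP[f1 f1z ->] ->]].
  by exists (act refl_aut f1) => //; apply: imset_f.
by exists f1.
Qed.

End ZUniformity.

(** * The flag count, the orbits and z-uniformity for [d], with [n] equal to [d.-1] *)

Theorem proposition4p3 (R : realFieldType) (d : nat) (hd : (3 <= d)%N) :
  let Pyr := pyramid (@cross_polytope R d.-1) in
  (#|flags Pyr d| = ((d + 1) * (d.-1)`! * 2 ^ d.-1)%N /\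
   partition (flag_orbits Pyr d) (flags Pyr d) /\
   #|flag_orbits Pyr d| = (d + 1)%N) /\
  z_uniform Pyr d.
Proof.
case: d hd => [|n] // n_gt1 /=; split; last exact: z_uniform_pyramid.
split; first exact: card_flags.
by split; [apply: flag_orbits_partition|apply: card_flag_orbits].
Qed.
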